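(* Let $\Omega$ be an open set of $\mathbb R^d$ with Lipschitz boundary. For $\varepsilon>0$ let $u_\varepsilon$ be functions defined on $(\Omega\times\varepsilon Q_{T,k})\cap\varepsilon X$, and write $u^\varepsilon_i=u_\varepsilon(\varepsilon i)$, with $u^\varepsilon_i=0$ for $i\in X$ with $i\notin\frac1\varepsilon\Omega\times Q_{T,k}$. Suppose that there is a constant $C$ such that, for all $\varepsilon>0$, $$\sum_{l\in\mathbb Z^d}\ \sum_{i\in(Q^l_{T,d}\times Q_{T,k})\cap X}\varepsilon^d|u^\varepsilon_i|^2\le C$$ and $$\sum_{l,l'\in\mathcal L_\varepsilon,\ |l-l'|=1}\ \ \sum_{i,j\in[(Q^l_{T,d}\cup Q^{l'}_{T,d}+(-M,M)^d)\times Q_{T,k}]\cap X}\varepsilon^{d-2}|u^\varepsilon_i-u^\varepsilon_j|^2\le C.$$ Then, up to a subsequence (as $\varepsilon\to0$), the piecewise-constant functions $$\overline u_\varepsilon(x^d)=\sum_{l\in I_\varepsilon}\tilde u^l_\varepsilon\,\chi_{\varepsilon Q^l_{T,d}}(x^d)$$ converge strongly in $L^2_{\rm loc}(\Omega)$ to some $u\in H^1(\Omega)$.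
   Context: Setting. Let $d,k\ge1$ and $T\in\mathbb N$, $T\ge1$. Put $Q_{T,d}=[0,T)^d$, $Q^l_{T,d}=lT+[0,T)^d$ for $l\in\mathbb Z^d$, and $Q_{T,k}=[0,T)^k$. $X\subset\mathbb Z^d\times\{0,\dots,T-1\}^k$ is a fixed nonempty set and $\mathcal E\subset X\times X$ is a set of edges such that: (i) $X$ is $T$-periodic in $e_1,\dots,e_d$ ($X+Te_m=X$ for $m=1,\dots,d$); (ii) for all $i,j\in X$ there is a finite sequence $i_0=i,i_1,\dots,i_N=j$ in $X$ with $(i_n,i_{n+1})\in\mathcal E$ for every $n$, and $\mathcal E$ is $T$-periodic, i.e. invariant under $(i,j)\mapsto(i+Te_m,j+Te_m)$, $m=1,\dots,d$; (iii) there is $R>0$ with $|i-j|\le R$ for all $(i,j)\in\mathcal E$; upon replacing $T$ by a multiple, $R\le T$ is assumed. Notation. $\tilde u^l_\varepsilon=\frac1{\#[(Q_{T,d}\times Q_{T,k})\cap X]}\sum_{i\in(Q^l_{T,d}\times Q_{T,k})\cap X}u^\varepsilon_i$. $I_\varepsilon=\{l\in\mathbb Z^d:\varepsilon Q^l_{T,d}\subset\Omega\}$. $\mathcal L_\varepsilon=\{l\in\mathbb Z^d:\ \varepsilon Tl\in\Omega,\ \operatorname{dist}(\varepsilon Tl,\partial\Omega)>2\varepsilon\sqrt d\,T\}$. $M>0$ is a fixed constant for which, for some $C'>0$, the inequality $|\tilde v^l-\tilde v^{l'}|^2\le C'\sum_{i,j\in[(Q^l_{T,d}\cup Q^{l'}_{T,d}+(-M,M)^d)\times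 Q_{T,k}]\cap X}|v_i-v_j|^2$ holds for all $v:X\to\mathbb R$ and all $l,l'\in\mathbb Z^d$ with $|l-l'|=1$ (where $\tilde v^l$ is the analogous average of $v$); the paper remarks that one may choose $M=T$ (up to replacing $T$ by a multiple). *)

(* Defs.v *)
From HB Require Import structures.
From mathcomp Require Import all_boot all_order all_algebra finmap.
From mathcomp Require Import all_classical all_reals all_analysis.

Set Implicit Arguments.
Unset Strict Implicit.
Unset Printing Implicit Defensive.

Import Order.TTheory GRing.Theory Num.Theory.
Import numFieldNormedType.Exports.

Local Open Scope classical_set_scope.
Local Open Scope ring_scope.

(** * Lebesgue measure on R^n *)

Section measurable_rV.
Context {R : realType} (n : nat).

Let coors : 'I_n -> 'rV[R]_n -> R := fun i x => x ord0 i.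

Let rV_set0 : g_sigma_preimage coors set0.
Proof. exact: sigma_algebra0. Qed.

Let rV_setC A : g_sigma_preimage coors A -> g_sigma_preimage coors (~` A).
Proof. exact: sigma_algebraC. Qed.

Let rV_bigcup (F : (set 'rV[R]_n)^nat) :
  (forall i, g_sigma_preimage coors (F i)) ->
  g_sigma_preimage coors (\bigcup_i (F i)).
Proof. exact: sigma_algebra_bigcup. Qed.

(* The product sigma-algebra, i.e. the Borel sets of R^n. *)
HB.instance Definition _ := @isMeasurable.Build default_measure_display
  'rV[R]_n (g_sigma_preimage coors) rV_set0 rV_setC rV_bigcup.

Lemma measurable_coord (i : 'I_n) :
  measurable_fun [set: 'rV[R]_n] (fun x : 'rV[R]_n => x ord0 i).
Proof.
move=> _ Y mY; rewrite setTI; apply: sub_sigma_algebra => /=.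
rewrite -bigcup_seq/=; exists i => /=; first by rewrite mem_index_enum.
by exists Y => //; rewrite setTI.
Qed.

Lemma measurable_fun_coordP d (T : measurableType d) (f : T -> 'rV[R]_n) :
  (forall i, measurable_fun [set: T] (fun x => f x ord0 i)) ->
  measurable_fun [set: T] f.
Proof.
move=> mf; suff H : g_sigma_preimage (fun i => coors i \o f) `<=` measurable.
  move=> _ A mA; apply: H; rewrite g_sigma_preimage_comp.
  by exists A => //.
apply: smallest_sub; first exact: sigma_algebra_measurable.
rewrite -bigcup_seq => A [i _] [B mB <-].
exact: mf.
Qed.

End measurable_rV.

Section lebesgue_measure_rV.
Context {R : realType}.

Definition rV_cons n (p : 'rV[R]_n * measurableTypeR R) : 'rV[R]_n.+1 :=
  row_mx (const_mx p.2 : 'rV[R]_1) p.1.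

Lemma measurable_rV_cons n : measurable_fun setT (@rV_cons n).
Proof.
apply: measurable_fun_coordP => i; rewrite /rV_cons.
case: (@split_ordP 1 n i) => j ->.
- apply: (eq_measurable_fun snd) => [p _|].
    by apply/esym; rewrite [LHS](row_mxEl (const_mx p.2 : 'rV[R]_1)) mxE.
  exact: measurable_snd.
- apply: (eq_measurable_fun (fun p : 'rV[R]_n * measurableTypeR R => p.1 ord0 j)) => [p _|].
    by apply/esym; rewrite [LHS](row_mxEr (const_mx p.2 : 'rV[R]_1)).
  exact: (measurableT_comp (measurable_coord j) measurable_fst).
Qed.

(* The measure instance of pushforward takes the measurability of the map as an
   argument that unification cannot find, hence the explicit projection. *)
Definition lebesgue_rV_step n (mu : {measure set 'rV[R]_n -> \bar R}) :
    {measure set 'rV[R]_n.+1 -> \bar R} :=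
  measure_function_pushforward__canonical__measure_function_Measure
    (mu \x @lebesgue_measure R)%E (@measurable_rV_cons n).

(* L^0 is the Dirac mass on the one-point space R^0, and L^{n+1} is the image of
   the product measure L^n x L^1 under (x', t) |-> (t, x'). *)
Fixpoint lebesgue_rV n : {measure set 'rV[R]_n -> \bar R} :=
  match n with
  | 0 => \d_(0 : 'rV[R]_0)
  | n'.+1 => lebesgue_rV_step (lebesgue_rV n')
  end.

Lemma lebesgue_rVS n (A : set 'rV[R]_n.+1) :
  lebesgue_rV n.+1 A =
  pushforward (lebesgue_rV n \x @lebesgue_measure R)%E (@rV_cons n) A.
Proof. by []. Qed.

End lebesgue_measure_rV.

(** * Open sets with Lipschitz boundary, L^2_loc and H^1 *)

Section function_spaces.
Context {R : realType} {d : nat}.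
Implicit Types (x : 'rV[R]_d) (Om : set 'rV[R]_d) (f g u phi : 'rV[R]_d -> R).

Definition enorm n (x : 'rV[R]_n) : R := Num.sqrt (\sum_m x ord0 m ^+ 2).

(* dist(x, A), equal to +oo when A is empty. *)
Definition edist_set x (A : set 'rV[R]_d) : \bar R :=
  ereal_inf [set (enorm (x - y))%:E | y in A].

Definition boundary Om : set 'rV[R]_d := closure Om `\` Om^°.

(* Near each boundary point there are orthonormal coordinates (those of
   y *m A) in which Om is the set lying above the graph of a Lipschitz function
   g of all the coordinates but the j-th one. *)
Definition lipschitz_boundary Om : Prop :=
  forall x, boundary Om x ->
  exists (A : 'M[R]_d) (j : 'I_d) (g : 'rV[R]_d.-1 -> R),
    [/\ A *m A^T = 1%:M, lipschitz g &
        \forall y \near x,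
          Om y <-> g (col' j (y *m A)) < (y *m A) ord0 j].

Definition partial (m : 'I_d) f : 'rV[R]_d -> R :=
  fun x => 'D_(delta_mx ord0 m) f x.

Definition partials (s : seq 'I_d) f : 'rV[R]_d -> R := foldr partial f s.

Definition smooth f : Prop :=
  forall s : seq 'I_d, continuous (partials s f) /\
    forall m x, derivable (partials s f) x (delta_mx ord0 m).

(* phi \in C_c^oo(Om), seen as a function on R^d *)
Definition test_function Om phi : Prop :=
  let supp := closure [set x | phi x != 0] in
  [/\ smooth phi, compact supp & supp `<=` Om].

(* f \_ Om is f extended by 0 outside Om. *)
Definition L2 Om f : Prop := f \_ Om \in Lfun (lebesgue_rV d) 2%:E.

Definition weak_partial Om (m : 'I_d) u g : Prop :=
  forall phi, test_function Om phi ->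
    (\int[lebesgue_rV d]_(x in Om) (u x * partial m phi x)%:E =
     - \int[lebesgue_rV d]_(x in Om) (g x * phi x)%:E)%E.

Definition H1 Om u : Prop :=
  L2 Om u /\ forall m : 'I_d, exists2 g, L2 Om g & weak_partial Om m u g.

Definition cvg_L2loc Om (f : nat -> 'rV[R]_d -> R) u : Prop :=
  forall K, compact K -> K `<=` Om ->
    ('N[lebesgue_rV d]_2%:E [EFin \o ((f n \- u)%R \_ K)] @[n --> \oo] --> 0)%E.

End function_spaces.

(** * The lattice X in Z^d x {0, ..., T-1}^k *)

(* Points of Z^{d+k}, split as (i.1, i.2) *)
Notation site d k := ('rV[int]_d * 'rV[int]_k)%type.

Section lattice.
Context {R : realType} {d k : nat}.
Local Notation site := (site d k).

Implicit Types (X : set site) (T : nat) (i : site) (l : 'rV[int]_d).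
Implicit Types (Om : set 'rV[R]_d) (v : site -> R) (e M : R).

Definition rvec n (z : 'rV[int]_n) : 'rV[R]_n := map_mx intr z.

Definition site_norm i : R := enorm (row_mx (rvec i.1) (rvec i.2)).

(* i + T e_m, for m <= d *)
Definition site_shift T (m : 'I_d) i : site :=
  (i.1 + T%:Z *: delta_mx ord0 m, i.2).

(* Q^l_{T,n} = l T + [0, T)^n *)
Definition cube n T (l : 'rV[int]_n) : set 'rV[R]_n :=
  [set x | forall m, (x - T%:R *: rvec l) ord0 m \in `[0, T%:R[].

(* (A x Q_{T,k}) \cap X *)
Definition sites X T (A : set 'rV[R]_d) : set site :=
  [set i | (A `*` cube T 0) (rvec i.1, rvec i.2)] `&` X.

Definition open_box M : set 'rV[R]_d :=
  [set z | forall m, z ord0 m \in `]- M, M[].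

(* (Q^l_{T,d} \cup Q^l'_{T,d}) + (-M, M)^d *)
Definition fat_pair T M l l' : set 'rV[R]_d :=
  [set y + z | y in cube T l `|` cube T l' & z in open_box M].

(* Both index sets are finite; by periodicity of X they have the same size. *)
Definition cell_mean X T v l : R :=
  (#|` fset_set (sites X T (cube T 0))|%fset%:R)^-1
  * \sum_(i \in sites X T (cube T l)) v i.

(* The sum over all i, j in ((A x Q_{T,k}) \cap X), with weight w *)
Definition energy X T (A : set 'rV[R]_d) (w : R) v : \bar R :=
  \esum_(ij in sites X T A `*` sites X T A)
     (w * `|v ij.1 - v ij.2| ^+ 2)%:E.

Definition poincare_width X T M : Prop :=
  exists2 C' : R, 0 < C' &
    forall v l l', enorm (rvec (l - l')) = 1 ->
      ((`|cell_mean X T v l - cell_mean X T v l'| ^+ 2)%:E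
        <= C'%:E * energy X T (fat_pair T M l l') 1 v)%E.

(* u^eps_i : u_eps at eps i when i \in (1/eps) Om x Q_{T,k}, and 0 otherwise *)
Definition sample T Om (u : R -> 'rV[R]_d * 'rV[R]_k -> R) e : site -> R :=
  fun i =>
    if `[< ([set e^-1 *: y | y in Om] `*` cube T 0) (rvec i.1, rvec i.2) >]
    then u e (e *: rvec i.1, e *: rvec i.2) else 0.

Definition eps_cube T e l : set 'rV[R]_d := [set e *: y | y in cube T l].

(* I_eps *)
Definition inner_cells T Om e : set 'rV[int]_d :=
  [set l | eps_cube T e l `<=` Om].

(* L_eps *)
Definition deep_cells T Om e : set 'rV[int]_d :=
  [set l | Om (e *: (T%:R *: rvec l)) /\
    ((2 * e * Num.sqrt d%:R * T%:R)%:E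
       < edist_set (e *: (T%:R *: rvec l)) (boundary Om))%E].

Definition deep_pairs T Om e : set ('rV[int]_d * 'rV[int]_d) :=
  [set ll | [/\ deep_cells T Om e ll.1, deep_cells T Om e ll.2 &
                enorm (rvec (ll.1 - ll.2)) = 1 :> R]].

(* At each x at most one term is nonzero. *)
Definition piecewise_mean X T Om e v : 'rV[R]_d -> R :=
  fun x => \sum_(l \in inner_cells T Om e)
             cell_mean X T v l * \1_(eps_cube T e l) x.

End lattice.
Arguments site_norm {R d k} i.

(* Main.v *)
(** Write h = eps T and let v be the cell means, so that the piecewise constant
    function is v o cell_of h away from the boundary.  The two bounds say that
    h^d sum |v|^2 and h^(d-2) sum |v(l + e_m) - v(l)|^2 (over deep cells) stay
    bounded.  Walking from l to l + a one unit step at a time gives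
    sum |v(l + a) - v(l)|^2 <= |a|_1^2 sum |discrete gradient|^2, and summing over
    the pairs of h-cells that meet a common cube of side delta yields a Poincare
    inequality: at scale delta the function differs from its averages over the
    delta-cubes by O(delta) in L^2, uniformly in eps.  Along an ultrafilter all
    these averages converge; the limiting averages at scales 2^-j form a Cauchy
    sequence in L^2 of every compact subset, whose limit u is a strong limit of
    a subsequence.  The discrete gradients are bounded in L^2, hence have a weak
    limit, and summation by parts against test functions sampled at the lattice
    points identifies it with the gradient of u. *)
Require Import Defs.
From mathcomp Require Import all_boot all_order all_algebra.
From mathcomp Require Import all_classical all_reals all_analysis.
From mathcomp Require Import measurable_realfun zify ring lra.
Set Implicit Arguments.
Unset Strict Implicit.
Unset Printing Implicit Defensive.
Import Order.TTheory GRing.Theory Num.Theory.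
Import numFieldNormedType.Exports.
Local Open Scope classical_set_scope.
Local Open Scope ring_scope.

(** * Boxes, lattice cells and open sets *)

Section lebesgue_boxes.
Context {R : realType}.

(** The energy bound sees only pairs of cells that keep a distance of order h from the boundary, so
    every estimate is local: [inner_set Om i] keeps a margin 1/(i+1) inside Om, and a walk between
    two cells is usable only if it stays within that margin. The grids of sides h and delta are not
    nested; averages over delta-cubes therefore weigh each h-cell by the volume of the overlap, and
    the Poincare constant is uniform because these weights add up to delta^d over a cube and to at
    most h^d over a cell. The ultrafilter replaces a diagonal extraction: averages over all cubes at
    all scales converge at once, and a true subsequence is chosen only at the end, with squared
    error C/4^i on [inner_set Om i]. Although the convergence is local, u and its gradient are
    square integrable on all of Om, because the two discrete bounds do not depend on the compact
    set: Fatou's lemma transfers the first one, and the second one passes to a weak limit taken on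
    the whole space, with the difference quotients set to 0 off the deep cells. *)

Lemma measurable_box n (a b : 'rV[R]_n) :
  measurable [set x : 'rV[R]_n | forall m, x ord0 m \in `[a ord0 m, b ord0 m[].
Proof.
have -> : [set x : 'rV[R]_n | forall m, x ord0 m \in `[a ord0 m, b ord0 m[] =
    \bigcap_(m in [set: 'I_n])
      ((fun x : 'rV[R]_n => x ord0 m) @^-1` [set` `[a ord0 m, b ord0 m[]).
  by apply/seteqP; split => x /= xP m; [move=> _|]; exact: xP.
apply: fin_bigcap_measurable => // m _.
rewrite -[X in measurable X]setTI.
by apply: measurable_coord => //; exact: measurable_itv.
Qed.

Lemma lebesgue_rV_box n (a b : 'rV[R]_n) :
  (forall m, a ord0 m <= b ord0 m) ->
  lebesgue_rV n [set x | forall m, x ord0 m \in `[a ord0 m, b ord0 m[] =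
  (\prod_m (b ord0 m - a ord0 m))%:E.
Proof.
elim: n a b => [|n IHn] a b ab.
  rewrite big_ord0 /= diracE mem_set//=.
  by case.
rewrite lebesgue_rVS /pushforward.
pose a' := \row_(m < n) a ord0 (@rshift 1 n m).
pose b' := \row_(m < n) b ord0 (@rshift 1 n m).
have -> : @rV_cons R n @^-1` [set x | forall m, x ord0 m \in `[a ord0 m, b ord0 m[] =
    [set x : 'rV[R]_n | forall m, x ord0 m \in `[a' ord0 m, b' ord0 m[] `*`
    [set` `[a ord0 (@lshift 1 n ord0), b ord0 (@lshift 1 n ord0)[].
  apply/seteqP; split => [[p t]|[p t] [/= pP tP] m] /=.
    rewrite /rV_cons /= => xP; split => [m|] /=.
      have := xP (@rshift 1 n m).
      by rewrite [in X in X -> _](row_mxEr (const_mx t : 'rV[R]_1)) !mxE.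
    have := xP (@lshift 1 n ord0).
    by rewrite [in X in X -> _](row_mxEl (const_mx t : 'rV[R]_1)) mxE.
  rewrite /rV_cons /=; case: (@split_ordP 1 n m) => j ->.
    by rewrite (row_mxEl (const_mx t : 'rV[R]_1)) mxE (ord1 j).
  by rewrite (row_mxEr (const_mx t : 'rV[R]_1)); have := pP j; rewrite !mxE.
rewrite product_measure1E//; last exact: measurable_box.
rewrite IHn; last by move=> m; rewrite !mxE.
rewrite [X in (_ * X)%E](lebesgue_measure_itv `[_, _[)/=.
rewrite (@big_split_ord _ _ _ 1 n) /= big_ord1 mulrC EFinM; congr (_ * _)%E.
  by congr (_%:E); apply: eq_bigr => m _; rewrite !mxE.
rewrite lte_fin; case: ltP => // ba; apply/eqP.
by rewrite eqe eq_sym subr_eq0 eq_le ba ab.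
Qed.

End lebesgue_boxes.

Section countable_partition.
Context d (T : measurableType d) {R : realType} (mu : {measure set T -> \bar R}).
Context (I : countType) (phi : T -> I).
Context (mphi : forall i, measurable (phi @^-1` [set i])).

Lemma measurable_preimage_countable (A : set I) : measurable (phi @^-1` A).
Proof.
have -> : phi @^-1` A = \bigcup_(i in A) phi @^-1` [set i].
  by apply/seteqP; split => [x Ax|x [i Ai /= ->]//]; exists (phi x).
rewrite bigcup_mkcond; apply: countable_bigcupT_measurable => [|i].
  exact: countableP.
by case: ifP.
Qed.

Lemma measurable_fun_countable d' (T' : sigmaRingType d') (F : I -> T') :
  measurable_fun setT (fun x => F (phi x)).
Proof. by move=> _ A mA; rewrite setTI; exact: (measurable_preimage_countable (F @^-1` A)). Qed.

(** Step functions are integrated through this formula, with [phi] the cell of a point or its pair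
    of cells in two grids. *)
Lemma ge0_integral_partition (s : seq I) (G : I -> \bar R) :
  uniq s -> (forall i, (0 <= G i)%E) ->
  (\int[mu]_(x in [set x | phi x \in s]) G (phi x) =
   \sum_(i <- s) G i * mu (phi @^-1` [set i]))%E.
Proof.
move=> us G0.
have sE : [set x | phi x \in s] = \big[setU/set0]_(i <- s) (phi @^-1` [set i]).
  rewrite -bigcup_seq; apply/seteqP; split => [x xs|x [i /= si ->]//].
  by exists (phi x).
rewrite sE ge0_integral_bigsetU//; last 2 first.
- by move=> i j _ _ [x [/= <- <-]].
- apply: (measurable_funS measurableT) => //.
  exact: measurable_fun_countable.
apply: eq_bigr => i _; rewrite -integral_cst//.
by apply: eq_integral => x /set_mem /= ->.
Qed.

End countable_partition.

Section lattice_cells.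
Context {R : realType} {d : nat}.
Implicit Types (x y : 'rV[R]_d) (h : R) (l q : 'rV[int]_d).

Definition cell_of h x : 'rV[int]_d := \row_m Num.floor (x ord0 m / h).
Definition grid_cell h l : set 'rV[R]_d := cell_of h @^-1` [set l].

(** Balls of row vectors are cubes, the metric being the sup metric. Positivity of the radius is
    part of being in a ball, and the coordinates cannot supply it when d = 0. *)
Lemma ballP x y h : 0 < h ->
  ball x h y <-> forall m, `|x ord0 m - y ord0 m| < h.
Proof.
move=> h0; split => [[_ /(_ ord0)] //|xy]; split => // i m.
by rewrite (ord1 i); exact: xy.
Qed.

Lemma grid_cellP h l x : 0 < h -> grid_cell h l x <->
  forall m, x ord0 m \in `[h * (l ord0 m)%:~R, h * (l ord0 m)%:~R + h[.
Proof.
move=> h0; rewrite /grid_cell /cell_of /=; split => [<- m|lP].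
  rewrite mxE in_itv/= -[X in _ + X]mulr1 -mulrDr !(mulrC h).
  rewrite -ler_pdivlMr// -ltr_pdivrMr//.
  by have := floor_itv (x ord0 m / h); rewrite intrD.
apply/rowP => m; rewrite mxE; apply: floor_def.
have := lP m; rewrite in_itv/= -[X in _ + X]mulr1 -mulrDr !(mulrC h).
by rewrite -ler_pdivlMr// -ltr_pdivrMr// intrD.
Qed.

Lemma cell_ofP h x m : 0 < h ->
  h * (cell_of h x ord0 m)%:~R <= x ord0 m < h * (cell_of h x ord0 m)%:~R + h.
Proof.
by move=> h0; have /(grid_cellP _ _ h0) /(_ m) := erefl (cell_of h x); rewrite in_itv.
Qed.

Lemma cell_of_dist h x y m : 0 < h -> cell_of h x = cell_of h y ->
  `|x ord0 m - y ord0 m| < h.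
Proof.
move=> h0 xy; have /andP[] := cell_ofP x m h0; have /andP[] := cell_ofP y m h0.
by rewrite xy ltr_norml => ? ? ? ?; apply/andP; split; lra.
Qed.

Lemma grid_cell_box h l : 0 < h -> grid_cell h l = [set x : 'rV[R]_d | forall m,
  x ord0 m \in `[(h *: map_mx intr l) ord0 m, (\row_j (h * (l ord0 j)%:~R + h)) ord0 m[].
Proof.
move=> h0; apply/seteqP; split => x /=.
  by move=> /(grid_cellP _ _ h0) xl m; rewrite !mxE; exact: xl.
by move=> xl; apply/grid_cellP => // m; have := xl m; rewrite !mxE.
Qed.

Lemma measurable_grid_cell h l : 0 < h -> measurable (grid_cell h l).
Proof. by move=> h0; rewrite grid_cell_box//; exact: measurable_box. Qed.

Lemma lebesgue_grid_cell h l : 0 < h -> lebesgue_rV d (grid_cell h l) = (h ^+ d)%:E.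
Proof.
move=> h0; rewrite grid_cell_box// lebesgue_rV_box.
  under eq_bigr => m _ do rewrite !mxE addrAC subrr add0r.
  by rewrite prodr_const card_ord.
by move=> m; rewrite !mxE lerDl ltW.
Qed.

(** The sigma-algebra is generated by the coordinates, so an open set has to be exhibited as a
    countable union of boxes: the grid cells of side 1/(j+1) that it contains. They cover it, since
    a cell around x of side less than e lies in the sup-norm ball of radius e. *)
Lemma measurable_open (A : set 'rV[R]_d) : open A -> measurable A.
Proof.
move=> oA.
pose F (jq : nat * 'rV[int]_d) :=
  if asbool (grid_cell jq.1.+1%:R^-1 jq.2 `<=` A) then grid_cell jq.1.+1%:R^-1 jq.2
  else set0.
have -> : A = \bigcup_jq F jq.
  apply/seteqP; split => [x Ax|x [[j q] _]]; last first.
    by rewrite /F /=; case: asboolP => [sA /sA|_ []].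
  have /nbhs_ballP[_/posnumP[e] eA] := oA _ Ax.
  have [N _ /(_ N (leqnn N)) /= Ne] := near_infty_natSinv_lt e.
  exists (N, cell_of N.+1%:R^-1 x) => //.
  rewrite /F /=; case: asboolP => //; case => y yx.
  apply: eA; apply/ballP => // m.
  by apply: lt_trans Ne; apply: cell_of_dist.
apply: countable_bigcupT_measurable => [|[j q]]; first exact: countableP.
by rewrite /F; case: ifP => // _; exact: measurable_grid_cell.
Qed.

Lemma measurable_closed (A : set 'rV[R]_d) : closed A -> measurable A.
Proof.
by move=> /closed_openC /measurable_open /measurableC; rewrite setCK.
Qed.

Lemma continuous_measurable (f : 'rV[R]_d -> R) :
  continuous f -> measurable_fun setT f.
Proof.
move=> /continuousP cf mD.
apply: (measurability _ (measurable_realfun.RGenOpens.measurableE R)) => //.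
move=> _ [_ [a [b ->] <-]]; rewrite setTI.
by apply: measurable_open; exact/cf/interval_open.
Qed.

End lattice_cells.

(** * Square-integrable functions *)

Section square_integrals.
Context d (T : measurableType d) (R : realType) (mu : {measure set T -> \bar R}).
Implicit Types (D : set T) (f g : T -> R).

(** Extended-valued, so that squared norms can be compared before they are known to be finite. *)
Definition sqint D f : \bar R := (\int[mu]_(x in D) (f x ^+ 2)%:E)%E.

Let mT f D : measurable D -> measurable_fun setT f ->
  measurable_fun D (fun x => (f x ^+ 2)%:E).
Proof.
move=> mD mf; apply/measurable_EFinP; apply: measurable_funX.
exact: measurable_funS mf.
Qed.

Lemma sqint_ge0 D f : (0 <= sqint D f)%E.
Proof. by apply: integral_ge0 => x _; rewrite lee_fin sqr_ge0. Qed.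

Lemma le_sqint D f g : measurable D -> measurable_fun setT f ->
  measurable_fun setT g -> (forall x, D x -> `|f x| <= `|g x|) ->
  (sqint D f <= sqint D g)%E.
Proof.
move=> mD mf mg fg; apply: ge0_le_integral => //.
- by move=> x _; rewrite lee_fin sqr_ge0.
- exact: mT.
- exact: mT.
- move=> x Dx; rewrite lee_fin -(real_normK (num_real (f x))).
  by rewrite -(real_normK (num_real (g x))) lerXn2r ?nnegrE// fg.
Qed.

Lemma eq_sqint D f g : (forall x, D x -> f x = g x) -> sqint D f = sqint D g.
Proof.
by move=> fg; apply: eq_integral => x /set_mem Dx; rewrite fg.
Qed.

Lemma sub_sqint D D' f : measurable D -> measurable D' -> measurable_fun setT f ->
  D `<=` D' -> (sqint D f <= sqint D' f)%E.
Proof.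
move=> mD mD' mf DD'; apply: ge0_subset_integral => //; first exact: mT.
by move=> x _; rewrite lee_fin sqr_ge0.
Qed.

Lemma sqint_restrict D f : sqint D f = sqint setT (f \_ D).
Proof.
rewrite /sqint integral_mkcond; apply: eq_integral => x _.
by rewrite /patch; case: ifP => // _; rewrite expr0n.
Qed.

Lemma sqintD D f g : measurable D -> measurable_fun setT f -> measurable_fun setT g ->
  (sqint D (f \+ g)%R <= 2%:E * sqint D f + 2%:E * sqint D g)%E.
Proof.
move=> mD mf mg.
rewrite /sqint -!ge0_integralZl_EFin//; try exact: mT;
  try by move=> x _; rewrite lee_fin sqr_ge0.
rewrite -ge0_integralD//; try exact: mT;
  try (by move=> x _; rewrite -?EFinM lee_fin mulr_ge0 ?sqr_ge0);
  try (by apply: measurable_funeM; exact: mT).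
apply: ge0_le_integral => //.
- by move=> x _; rewrite lee_fin sqr_ge0.
- by apply: mT => //; exact: measurable_funD.
- by apply: emeasurable_funD; apply: measurable_funeM; exact: mT.
- move=> x _; rewrite -!EFinM -EFinD lee_fin /=.
  have := sqr_ge0 (f x - g x); rewrite !expr2; nra.
Qed.

Lemma sqintB D f g (a b : R) : measurable D -> measurable_fun setT f ->
  measurable_fun setT g -> (sqint D f <= a%:E)%E -> (sqint D g <= b%:E)%E ->
  (sqint D (f \- g)%R <= (2 * (a + b))%:E)%E.
Proof.
move=> mD mf mg fa gb; have mN : measurable_fun setT (\- g).
  exact: measurableT_comp.
apply: le_trans (sqintD mD mf mN) _.
have -> : (2 * (a + b))%:E = (2%:E * a%:E + 2%:E * b%:E)%E.
  by rewrite -!EFinM -EFinD mulrDr.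
apply: leeD; rewrite lee_pmul2l//.
by apply: le_trans gb; rewrite /sqint; under eq_integral => x _ do rewrite sqrrN.
Qed.

End square_integrals.

Lemma sum_half_le (R : realType) n : \sum_(0 <= j < n) 2^-1 ^+ j <= 2 :> R.
Proof.
have -> : \sum_(0 <= j < n) 2^-1 ^+ j = 2 - 2 * 2^-1 ^+ n :> R.
  elim: n => [|n IHn]; first by rewrite big_nil expr0 mulr1 subrr.
  by rewrite big_nat_recr//= IHn exprS; field.
by rewrite gerBl mulr_ge0// exprn_ge0.
Qed.

(** By |x| <= 2^-j + 2^j x^2 the telescoping series converges absolutely. The weight 2^j is
    affordable for increments whose squares decay like 4^-j. *)
Lemma cvg_of_weighted_increments (R : realType) (a : R^nat) (S : R) :
  (forall n, \sum_(0 <= j < n) 2 ^+ j * (a j.+1 - a j) ^+ 2 <= S) -> cvgn a.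
Proof.
move=> aS; suff : cvgn (series (telescope a)).
  move=> ct; have -> : a = (fun n => a 0%N + series (telescope a) n).
    by apply/funext => n; rewrite -eq_sum_telescope.
  by apply: is_cvgD => //; exact: is_cvg_cst.
apply: normed_cvg; apply: nondecreasing_is_cvgn.
  by apply/nondecreasing_seqP => n /=; rewrite seriesSr lerDl.
exists (2 + S) => _ [n _ <-].
change (\sum_(0 <= j < n) `|telescope a j| <= 2 + S).
apply: (@le_trans _ _ (\sum_(0 <= j < n) (2^-1 ^+ j + 2 ^+ j * (a j.+1 - a j) ^+ 2))).
  apply: ler_sum => j _; rewrite /telescope /=.
  set x := `|_|; rewrite -(real_normK (num_real (a j.+1 - a j))) -/x.
  have p0 : 0 < 2 ^+ j :> R by rewrite exprn_gt0.
  rewrite exprVn -(ler_pM2l p0) mulrDr mulfV ?gt_eqF//.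
  by have := sqr_ge0 (2 ^+ j * x - 2^-1); rewrite !expr2; nra.
by rewrite big_split lerD// sum_half_le.
Qed.

(** * Completeness of L^2, simultaneously on a family of sets *)

Section sqint_completeness.
Context d (T : measurableType d) (R : realType) (mu : {measure set T -> \bar R}).

Lemma limn_einf_le (u : (\bar R)^nat) (c : \bar R) :
  (forall n, (u n <= c)%E) -> (limn_einf u <= c)%E.
Proof.
move=> uc; rewrite limn_einf_lim; apply: lime_le; first exact: is_cvg_einfs.
apply: nearW => n; apply: le_trans (uc n).
by apply: ereal_inf_lbound; exists n => /=.
Qed.

(** Fatou's lemma for the squares of f n - g; shifting the sequence by N discards the indices at
    which the bound does not hold yet. *)
Lemma sqint_limit_le (D : set T) (f : nat -> T -> R) (u g : T -> R) (c : R) :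
  measurable D -> (forall n, measurable_fun setT (f n)) ->
  measurable_fun setT u -> measurable_fun setT g ->
  {ae mu, forall x, D x -> f n x @[n --> \oo] --> u x} ->
  (\forall n \near \oo, sqint mu D (f n \- g)%R <= c%:E)%E ->
  (sqint mu D (u \- g)%R <= c%:E)%E.
Proof.
move=> mD mf mfu mg fu [N _ fc].
have mX (v : T -> R) : measurable_fun setT v ->
    measurable_fun D (fun x => ((v x - g x) ^+ 2)%:E).
  move=> mv; apply/measurable_EFinP; apply: measurable_funX.
  by apply: measurable_funS (measurable_funB mv mg).
pose F n x := ((f (n + N)%N x - g x) ^+ 2)%:E.
have F0 n x : D x -> (0 <= F n x)%E by move=> _; rewrite lee_fin sqr_ge0.
apply: (@le_trans _ _ (\int[mu]_(x in D) limn_einf (F^~ x)))%E; last first.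
  apply: (le_trans (fatou _ mD _ _)) => //; first by move=> n; exact: mX.
  by apply: limn_einf_le => n; apply: (fc (n + N)%N); exact: leq_addl.
apply: ae_ge0_le_integral => //.
- by move=> x _; rewrite lee_fin sqr_ge0.
- exact: mX.
- move=> x Dx; rewrite limn_einf_lim; apply: lime_ge; first exact: is_cvg_einfs.
  by apply: nearW => n; apply: le_ereal_inf_tmp => _ [m _ <-]; exact: F0.
- rewrite (_ : (fun x => _) = (fun x => - limn_esup (fun n => - F n x))%E)//.
  apply: measurableT_comp => //; apply: measurable_fun_limn_esup => n.
  by apply: measurableT_comp => //; exact: mX.
apply: filterS fu => x fux Dx.
have /cvg_limn_einf_sup[-> _] : F n x @[n --> \oo] --> ((u x - g x) ^+ 2)%:E.
  apply: cvg_EFin; first exact: nearW.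
  rewrite (_ : _ \o _ = (fun n => (f (n + N)%N x - g x) ^+ 2))//.
  have cB : (f (n + N)%N x - g x) @[n --> \oo] --> (u x - g x).
    apply: cvgB; last exact: cvg_cst.
    by rewrite (cvg_shiftn N (f^~ x)); exact: fux.
  by rewrite expr2; under eq_fun => n do rewrite expr2; exact: cvgM.
by [].
Qed.

(** Riesz-Fischer with a geometric rate. Each set has its own threshold [J i], because a small set
    margin only tolerates fine scales; taking the pointwise limsup as the limit gives one measurable
    function that serves all the sets. *)
Lemma sqint_complete (K : nat -> set T) (f : nat -> T -> R) (J : nat -> nat) (C : R) :
  (forall i, measurable (K i)) -> (forall j, measurable_fun setT (f j)) ->
  (forall i j j', (J i <= j)%N -> (j <= j')%N ->
    (sqint mu (K i) (f j' \- f j)%R <= (C / 4 ^+ j)%:E)%E) ->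
  exists2 u : T -> R, measurable_fun setT u & forall i j, (J i <= j)%N ->
    (sqint mu (K i) (u \- f j)%R <= (C / 4 ^+ j)%:E)%E.
Proof.
move=> mK mf fC.
pose u x := fine (limn_esup (fun n => (f n x)%:E)).
have mfu : measurable_fun setT u.
  apply: measurableT_comp => //; apply: measurable_fun_limn_esup => n.
  exact/measurable_EFinP.
exists u => // i j Jij; apply: (@sqint_limit_le _ f) => //; last first.
  by exists j => // n /= jn; exact: fC Jij jn.
have C0 : 0 <= C.
  have := le_trans (sqint_ge0 _ _ _) (fC i _ _ (leqnn (J i)) (leqnn _)).
  by rewrite lee_fin pmulr_lge0// invr_gt0 exprn_gt0.
pose N := J i.
pose dl j x := f (j.+1 + N)%N x - f (j + N)%N x.
pose F j x := (2 ^+ j * dl j x ^+ 2)%:E.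
have F0 n x : (0 <= F n x)%E by rewrite lee_fin mulr_ge0 ?sqr_ge0// exprn_ge0.
have mdl n : measurable_fun setT (dl n) by exact: measurable_funB.
have mF n : measurable_fun (K i) (F n).
  apply/measurable_EFinP; apply: measurable_funM; first exact: measurable_cst.
  by apply: measurable_funX; exact: measurable_funS (mdl n).
(* The weight 2^n against increments of squared norm C/4^n leaves a convergent series, so G is
   integrable, hence finite almost everywhere; at such points the sequence converges. *)
pose G x := (\sum_(0 <= n <oo) F n x)%E.
have G0 x : (0 <= G x)%E by exact: nneseries_ge0.
have iG : mu.-integrable (K i) G.
  apply/integrableP; split; first exact: ge0_emeasurable_sum.
  under eq_integral => x _ do rewrite gee0_abs//.
  rewrite integral_nneseries//.
  apply: (@le_lt_trans _ _ (C * 2)%:E); last exact: ltry.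
  apply: lime_le.
    by apply: is_cvg_nneseries => n _ _; exact: integral_ge0.
  apply: nearW => n.
  apply: (@le_trans _ _ (\sum_(0 <= j < n) (C * 2^-1 ^+ j)%:E)%E).
    apply: lee_sum => m _; rewrite /F.
    under eq_integral => x _ do rewrite EFinM.
    rewrite ge0_integralZl_EFin//; last 2 first.
    - by move=> x _; rewrite lee_fin sqr_ge0.
    - apply/measurable_EFinP; apply: measurable_funX.
      exact: measurable_funS (mdl m).
    apply: (@le_trans _ _ ((2 ^+ m)%:E * (C / 4 ^+ m)%:E)%E).
      rewrite lee_pmul2l ?lte_fin ?exprn_gt0//.
      apply: le_trans (fC i (m + N)%N (m.+1 + N)%N _ _) _.
      - exact: leq_addl.
      - by rewrite leq_add2r.
      rewrite lee_fin ler_wpM2l// lef_pV2 ?posrE ?exprn_gt0//.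
      by rewrite ler_weXn2l// ?leq_addr// ler1n.
    rewrite -EFinM lee_fin (_ : 4 = 2 * 2 :> R)//; last by rewrite -natrM.
    rewrite exprMn invfM mulrCA exprVn ler_wpM2l//.
    by rewrite mulrA mulfV ?mul1r// expf_neq0.
  rewrite sumEFin lee_fin -mulr_sumr ler_wpM2l//.
  exact: sum_half_le.
apply: filterS (integrable_ae (mK i) iG) => x Gx Kx.
have {}Gx := Gx Kx.
have : cvgn (fun n => f (n + N)%N x).
  apply: (@cvg_of_weighted_increments _ _ (fine (G x))) => n.
  rewrite -lee_fin fineK// -sumEFin.
  exact: (@nneseries_lim_ge _ (F^~ x) xpredT 0%N n).
move=> /cvg_ex [l fl].
have {}fl : f n x @[n --> \oo] --> l by rewrite -(cvg_shiftn N).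
suff -> : u x = l by [].
have /cvg_limn_einf_sup[_ fl'] : (f n x)%:E @[n --> \oo] --> l%:E.
  by apply: cvg_EFin => //; exact: nearW.
by rewrite /u fl'.
Qed.

End sqint_completeness.

(** * The inner product of L^2 *)

Section square_integrable.
Context d (T : measurableType d) (R : realType) (mu : {measure set T -> \bar R}).
Implicit Types (f g p : T -> R).

Definition sqintegrable f :=
  measurable_fun setT f /\ (sqint mu setT f < +oo)%E.

Definition ip f g : R := (\int[mu]_x (f x * g x))%R.

Lemma sqintegrable_mul f g : sqintegrable f -> sqintegrable g ->
  mu.-integrable setT (EFin \o (fun x => f x * g x)).
Proof.
move=> [mf fl] [mg gl].
have mfg : measurable_fun setT (fun x => f x * g x) by exact: measurable_funM.
have iX p : measurable_fun setT p -> (sqint mu setT p < +oo)%E ->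
    mu.-integrable setT (EFin \o (fun x => p x ^+ 2)).
  move=> mp pl; apply/integrableP; split.
    by apply/measurable_EFinP; exact: measurable_funX.
  apply: le_lt_trans pl; rewrite le_eqVlt; apply/orP; left; apply/eqP.
  by apply: eq_integral => x _ /=; rewrite ger0_norm// sqr_ge0.
apply: (le_integrable measurableT
    (g := EFin \o (fun x => f x ^+ 2 + g x ^+ 2))).
- exact/measurable_EFinP.
- move=> x _ /=; rewrite lee_fin normrM [leRHS]ger0_norm ?addr_ge0 ?sqr_ge0//.
  rewrite -(real_normK (num_real (f x))) -(real_normK (num_real (g x))).
  move: (normr_ge0 (f x)) (normr_ge0 (g x)); move: `|f x| `|g x| => a b a0 b0.
  by have := mulr_ge0 a0 b0; have := sqr_ge0 (a - b); rewrite !expr2; lra.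
- exact: (integrableD measurableT (iX _ mf fl) (iX _ mg gl)).
Qed.

Lemma ipC f g : ip f g = ip g f.
Proof. by apply: eq_Rintegral => x _; rewrite mulrC. Qed.

Lemma ipDl f g p : sqintegrable f -> sqintegrable g -> sqintegrable p ->
  ip (f \+ g) p = ip f p + ip g p.
Proof.
move=> sf sg sp; rewrite /ip -RintegralD//; try exact: sqintegrable_mul.
by apply: eq_Rintegral => x _; rewrite mulrDl.
Qed.

Lemma ipZl c f p : sqintegrable f -> sqintegrable p ->
  ip (fun x => c * f x) p = c * ip f p.
Proof.
move=> sf sp; rewrite /ip -RintegralZl//; last exact: sqintegrable_mul.
by apply: eq_Rintegral => x _; rewrite mulrA.
Qed.

Lemma sqintE f : sqintegrable f -> sqint mu setT f = (ip f f)%:E.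
Proof.
move=> sf; rewrite /ip /Rintegral fineK; first last.
  by apply: (integrable_fin_num measurableT); exact: sqintegrable_mul.
by apply: eq_integral => x _; rewrite expr2.
Qed.

Lemma ip_ge0 f : sqintegrable f -> 0 <= ip f f.
Proof. by move=> sf; rewrite -lee_fin -sqintE// sqint_ge0. Qed.

Lemma sqintegrableD f g : sqintegrable f -> sqintegrable g -> sqintegrable (f \+ g).
Proof.
move=> sf sg; have [mf fl] := sf; have [mg gl] := sg.
split; first exact: measurable_funD.
apply: (le_lt_trans (sqintD mu measurableT mf mg)).
by rewrite !sqintE// -!EFinM -EFinD ltry.
Qed.

Lemma sqintegrableZ c f : sqintegrable f -> sqintegrable (fun x => c * f x).
Proof.
move=> sf; have [mf fl] := sf; split; first exact: measurable_funM.
rewrite /sqint; under eq_integral => x _ do rewrite exprMn EFinM.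
rewrite ge0_integralZl_EFin ?sqr_ge0//; last 2 first.
- by move=> x _; rewrite lee_fin sqr_ge0.
- by apply/measurable_EFinP; exact: measurable_funX.
by rewrite -/(sqint mu setT f) sqintE// -EFinM ltry.
Qed.

Lemma sqintegrableB f g : sqintegrable f -> sqintegrable g -> sqintegrable (f \- g).
Proof.
move=> sf sg; have := sqintegrableD sf (sqintegrableZ (-1) sg).
by under [X in sqintegrable X -> _]eq_fun => x do rewrite mulN1r.
Qed.

Lemma ipBl f g p : sqintegrable f -> sqintegrable g -> sqintegrable p ->
  ip (f \- g) p = ip f p - ip g p.
Proof.
move=> sf sg sp; rewrite -mulN1r -ipZl// -ipDl//; last exact: sqintegrableZ.
by congr ip; apply/funext => x /=; rewrite mulN1r.
Qed.

Lemma ipDr f g p : sqintegrable f -> sqintegrable g -> sqintegrable p ->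
  ip p (f \+ g) = ip p f + ip p g.
Proof. by move=> *; rewrite ipC ipDl// !(ipC p). Qed.

Lemma ipBr f g p : sqintegrable f -> sqintegrable g -> sqintegrable p ->
  ip p (f \- g) = ip p f - ip p g.
Proof. by move=> *; rewrite ipC ipBl// !(ipC p). Qed.

Lemma ipZr c f p : sqintegrable f -> sqintegrable p ->
  ip p (fun x => c * f x) = c * ip p f.
Proof. by move=> *; rewrite ipC ipZl// ipC. Qed.

(** Expand the squared norm of s t f - g for s = 1 and s = -1, then divide by t. This form of
    Cauchy-Schwarz avoids square roots; the weight t is tuned at each use. *)
Lemma ip_le (t : R) f g : 0 < t -> sqintegrable f -> sqintegrable g ->
  2 * `|ip f g| <= t * ip f f + t^-1 * ip g g.
Proof.
move=> t0 sf sg.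
have H s : s ^+ 2 = 1 -> 2 * (s * ip f g) <= t * ip f f + t^-1 * ip g g.
  move=> s1; have sh : sqintegrable (fun x => s * t * f x) by exact: sqintegrableZ.
  have := ip_ge0 (sqintegrableB sh sg).
  have sB := sqintegrableB sh sg.
  rewrite ipBl// !ipBr// !ipZl// !ipZr// (ipC g) => h.
  rewrite -(ler_pM2l t0) mulrDr [t * (t^-1 * _)]mulrA mulfV ?gt_eqF// mul1r.
  move: h; rewrite [s * t * (s * t * _)](_ : _ = s ^+ 2 * (t * (t * ip f f))).
    by rewrite s1; lra.
  by rewrite expr2; ring.
have [i0|i0] := ger0P (ip f g).
  by rewrite -[X in 2 * X]mul1r; apply: H; rewrite expr1n.
by rewrite -[X in 2 * X]mulN1r; apply: H; rewrite sqrrN expr1n.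
Qed.

End square_integrable.

(** Bolzano-Weierstrass without extraction: the image of an ultrafilter is an ultrafilter, and it
    converges in the compact interval [-b, b]. *)
Lemma ultra_bounded_cvg (R : realType) (I : Type) (U : set_system I) (a : I -> R) (b : R) :
  UltraFilter U -> (forall i, `|a i| <= b) -> cvg (a i @[i --> U]).
Proof.
move=> uU ab.
have UF : UltraFilter (a i @[i --> U]).
  split=> [|G PG aG]; first exact: fmap_proper_filter.
  apply/seteqP; split => [A GA|//].
  have [//|UA] := in_ultra_setVsetC (a @^-1` A) uU.
  have : G (~` A) by exact: aG.
  by move=> /(filterI GA); rewrite setICr => /filter_ex [].
have := @segment_compact R (- b) b.
rewrite compact_ultra => /(_ _ UF) [|l [_ al]]; last by apply/cvg_ex; exists l.
by apply: nearW => i /=; rewrite in_itv /= -ler_norml.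
Qed.

Lemma eq0_of_geometric_bound (R : realType) (x c : R) :
  (forall k, `|x| <= c * 2^-1 ^+ k) -> x = 0.
Proof.
move=> xc; apply/eqP; rewrite -normr_le0.
have : (fun k => c * 2^-1 ^+ k) @ \oo --> (c * 0 : R).
  apply: cvgM; first exact: cvg_cst.
  by apply: cvg_expr; rewrite ger0_norm ?invf_lt1 ?ltr1n.
rewrite mulr0 => h; rewrite -(cvg_lim _ h)//; apply: limr_ge; last exact: nearW.
by apply/cvg_ex; exists 0.
Qed.

(** * Weak compactness in L^2 *)

Section weak_limits.
Context d (T : measurableType d) (R : realType) (mu : {measure set T -> \bar R}).
Local Notation sqi := (sqintegrable mu).
Local Notation "''<' f , g >" := (ip mu f g)
  (at level 0, f at level 69, g at level 69, format "''<' f ,  g >").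

(* The weak limit represents the functional L(p) = lim_U <g_n, p>; it is found as
   the minimiser of |p|^2 - 2 L(p), whose minimising sequences are Cauchy by the
   parallelogram identity. *)
Lemma ultra_weak_limit (U : set_system nat) (g : nat -> T -> R) (C : R) :
  UltraFilter U -> (forall n, sqi (g n)) -> (forall n, '< g n, g n > <= C) ->
  exists2 g' : T -> R, sqi g' &
    forall p, sqi p -> '< g n, p > @[n --> U] --> '< g', p >.
Proof.
move=> uU sg gC.
pose L p := lim ('< g n, p > @[n --> U]).
have gp n p : sqi p -> `|'< g n, p >| <= (C + '< p, p >) / 2.
  move=> sp; have := ip_le ltr01 (sg n) sp; rewrite invr1 !mul1r.
  by have := gC n; lra.
have cL p : sqi p -> '< g n, p > @[n --> U] --> L p.
  by move=> sp; apply: ultra_bounded_cvg => n; exact: gp.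
have PU : ProperFilter U by exact: ultra_proper.
have LD p q : sqi p -> sqi q -> L (p \+ q) = L p + L q.
  move=> sp sq; apply/cvg_lim => //.
  rewrite (_ : (fun n => _) = (fun n => '< g n, p > + '< g n, q >)).
    by apply: cvgD; exact: cL.
  by apply/funext => n; rewrite ipDr.
have LZ c p : sqi p -> L (fun x => c * p x) = c * L p.
  move=> sp; apply/cvg_lim => //.
  rewrite (_ : (fun n => _) = (fun n => c * '< g n, p >)).
    by apply: cvgM; [exact: cvg_cst|exact: cL].
  by apply/funext => n; rewrite ipZr.
pose J p := '< p, p > - 2 * L p.
have J_ge p : sqi p -> - C <= J p.
  move=> sp; suff : L p <= (C + '< p, p >) / 2 by rewrite /J; lra.
  apply: (cvgr_to_le (cL p sp)).
  by apply: nearW => n; apply: le_trans (ler_norm _) (gp n p sp).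
pose S : set R := [set J p | p in sqi].
have hS : has_inf S.
  split; first by exists (J (g 0%N)), (g 0%N).
  by exists (- C) => _ [p sp <-]; exact: J_ge.
(* An excess of 4^-k over the infimum makes the sequence Cauchy at the rate that [sqint_complete]
   asks for. *)
have /choice[p pP] k : exists p, sqi p /\ J p < inf S + 4^-1 ^+ k.
  have e0 : 0 < 4^-1 ^+ k :> R by rewrite exprn_gt0.
  by have [_ [q sq <-] Jq] := inf_adherent e0 hS; exists q.
have sp k : sqi (p k) by case: (pP k).
have Jp k : J (p k) < inf S + 4^-1 ^+ k by case: (pP k).
have J_inf q : sqi q -> inf S <= J q.
  by move=> sq; apply: ge_inf; [case: hS|exists q].
have JDZ t q r : sqi q -> sqi r ->
    J (q \+ (fun x => t * r x)) = J q + 2 * t * ('< q, r > - L r) + t ^+ 2 * '< r, r >.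
  move=> sq sr; have sz := sqintegrableZ t sr; have sD := sqintegrableD sq sz.
  rewrite /J LD// LZ// ipDl// !ipDr// !ipZl// !ipZr// (ipC mu r) expr2; ring.
have [g' mg' g'p] : exists2 u : T -> R, measurable_fun setT u &
    forall (i j : nat), (0 <= j)%N -> (sqint mu setT (u \- p j)%R <= (4 / 4 ^+ j)%:E)%E.
  apply: (@sqint_complete _ _ _ mu (fun=> setT) p (fun=> 0%N)) => //.
    by move=> j; case: (sp j).
  move=> _ j j' _ jj'; have sB := sqintegrableB (sp j') (sp j).
  rewrite sqintE// lee_fin -exprVn.
  (* [JDZ] at t = 1 and t = 1/2 amounts to the parallelogram law: the squared norm of p j' - p j is
     2 J(p j) + 2 J(p j') - 4 J(midpoint), at most 2 (4^-j + 4^-j'). Hence the constant 4. *)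
  have := JDZ 2^-1 _ _ (sp j) sB.
  have := JDZ 1 _ _ (sp j) sB.
  rewrite (_ : p j \+ (fun x => 1 * _) = p j'); last first.
    by apply/funext => x /=; rewrite mul1r addrC subrK.
  have := J_inf _ (sqintegrableD (sp j) (sqintegrableZ 2^-1 sB)).
  have : 4^-1 ^+ j' <= 4^-1 ^+ j :> R.
    by rewrite ler_wiXn2l// ?invf_le1// ?ler1n.
  rewrite (_ : 2^-1 ^+ 2 = 4^-1 :> R); last by rewrite expr2 -invfM -natrM.
  rewrite expr1n; have := Jp j; have := Jp j'; lra.
have sg' : sqi g'.
  have s0 : sqi (g' \- p 0%N).
    split; first by apply: measurable_funB => //; case: (sp 0%N).
    by apply: le_lt_trans (g'p 0%N 0%N _) (ltry _).
  have := sqintegrableD s0 (sp 0%N).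
  by rewrite (_ : _ \+ _ = g')//; apply/funext => x /=; rewrite subrK.
exists g' => // q sq; suff -> : '< g', q > = L q by exact: cL.
apply/subr0_eq; apply: (@eq0_of_geometric_bound _ _ (3 + '< q, q >)) => k.
have e0 : 0 < 2^-1 ^+ k :> R by rewrite exprn_gt0.
have sB := sqintegrableB sg' (sp k).
have e2 : 4^-1 ^+ k = 2^-1 ^+ k * 2^-1 ^+ k :> R.
  by rewrite -exprMn; congr (_ ^+ _); rewrite -invfM -natrM.
(* Approximate optimality: adding 2^-k q or -2^-k q to p k cannot lower J by more than 4^-k, so the
   derivative of J at p k along q is of order 2^-k. *)
have pk : `|'< p k, q > - L q| <= 2^-1 ^+ k * (1 + '< q, q >) / 2.
  have H s : s ^+ 2 = 1 -> s * ('< p k, q > - L q) <= 2^-1 ^+ k * (1 + '< q, q >) / 2.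
    move=> s1; have := JDZ (- s * 2^-1 ^+ k) _ _ (sp k) sq.
    have := J_inf _ (sqintegrableD (sp k) (sqintegrableZ (- s * 2^-1 ^+ k) sq)).
    rewrite exprMn sqrrN s1 mul1r expr2.
    have := Jp k; rewrite e2; move: (J _) (J _) => a b ak ib bE.
    rewrite -(ler_pM2l e0); move: bE ak ib.
    move: (2^-1 ^+ k) (inf S) => e m; nra.
  rewrite ler_norml; apply/andP; split.
    by rewrite lerNl -mulN1r; apply: H; rewrite sqrrN expr1n.
  by rewrite -[leLHS]mul1r; apply: H; rewrite expr1n.
have gk : `|'< g', q > - '< p k, q >| <= 2^-1 ^+ k * (4 + '< q, q >) / 2.
  rewrite -ipBl//; have := ip_le (exprn_gt0 k (ltr0n R 2)) sB sq.
  have := g'p 0%N k isT; rewrite sqintE// lee_fin => h.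
  have : 2 ^+ k * '< g' \- p k, g' \- p k > <= 2^-1 ^+ k * 4.
    apply: (@le_trans _ _ (2 ^+ k * (4 / 4 ^+ k))).
      by rewrite ler_wpM2l// exprn_ge0.
    rewrite -exprVn e2 [leLHS](_ : _ = (2 ^+ k * 2^-1 ^+ k) * (2^-1 ^+ k * 4)).
      by rewrite -exprMn mulfV// expr1n mul1r.
    by ring.
  by rewrite -exprVn; lra.
apply: le_trans (_ : `|('< g', q > - '< p k, q >) + ('< p k, q > - L q)| <= _).
  by rewrite addrA subrK.
apply: le_trans (ler_normD _ _) _.
by have := mulr_ge0 (ltW e0) (ip_ge0 sq); lra.
Qed.

End weak_limits.

(** * Discrete Poincare inequality *)

Section finite_sums.
Context {R : realType}.

Lemma ler_sum_inj (I J : eqType) (s : seq I) (t : seq J) (f : I -> J) (G : J -> R) :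
  uniq s -> uniq t -> {in s &, injective f} -> {in s, forall x, f x \in t} ->
  (forall y, 0 <= G y) -> \sum_(x <- s) G (f x) <= \sum_(y <- t) G y.
Proof.
move=> us ut injf fst G0; rewrite -(big_map f xpredT G).
rewrite [leRHS](bigID (mem (map f s)))/= -[X in _ <= X + _]big_filter.
rewrite [X in _ <= X + _](perm_big (map f s)) ?lerDl ?sumr_ge0//.
apply: uniq_perm.
- exact: filter_uniq.
- by rewrite map_inj_in_uniq.
- move=> y; rewrite mem_filter andb_idr// => /mapP[x xs ->]; exact: fst.
Qed.

(** Both sides are polynomials in V and the first two moments c and S. The identity trades
    deviations from a mean for pairwise differences, which translations control. *)
Lemma weighted_variance (I : Type) (s : seq I) (w v : I -> R) (V : R) :
  V != 0 -> \sum_(i <- s) w i = V ->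
  \sum_(i <- s) w i * (v i - V^-1 * \sum_(j <- s) w j * v j) ^+ 2 =
  (2 * V)^-1 * \sum_(i <- s) \sum_(j <- s) w i * w j * (v j - v i) ^+ 2.
Proof.
move=> V0 wV; set c := \sum_(j <- s) w j * v j; set S := \sum_(j <- s) w j * v j ^+ 2.
have -> : \sum_(i <- s) \sum_(j <- s) w i * w j * (v j - v i) ^+ 2 =
    2 * V * S - 2 * c ^+ 2.
  transitivity (\sum_(i <- s) (w i * S + w i * v i ^+ 2 * V - 2 * (w i * v i * c))).
    apply: eq_bigr => i _; rewrite -wV /S /c !mulr_sumr -big_split -sumrB/=.
    by apply: eq_bigr => j _; ring.
  by rewrite sumrB big_split/= -!mulr_suml -mulr_sumr -mulr_suml wV -/S -/c; ring.
transitivity (\sum_(i <- s) (w i * v i ^+ 2 - 2 * V^-1 * c * (w i * v i)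
    + (V^-1 * c) ^+ 2 * w i)).
  by apply: eq_bigr => i _; ring.
by rewrite big_split/= sumrB -!mulr_sumr wV -/S -/c; field.
Qed.

End finite_sums.

Section lattice_steps.
Context {R : realType} {d : nat}.
Implicit Types (a b p l : 'rV[int]_d) (v : 'rV[int]_d -> R).
Local Notation unit_vec m := (delta_mx ord0 m : 'rV[int]_d).

Definition norm1 a : nat := (\sum_m `|a ord0 m|)%N.

(** One coordinate moves towards 0 and none grows in absolute value, so a walk made of such steps
    never leaves a box centred at 0. *)
Lemma norm1_step a : a != 0 ->
  exists m a', norm1 a = (norm1 a').+1 /\
    (forall j, `|a' ord0 j| <= `|a ord0 j|)%N /\
    (a = a' + unit_vec m \/ a' = a + unit_vec m).
Proof.
move=> a0; have [m am] : exists m, a ord0 m != 0.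
  apply: contrapT => h; case/eqP: a0; apply/rowP => m; rewrite mxE; apply/eqP.
  by apply: contrapT => am; apply: h; exists m; exact/negP.
pose a' := a - Num.sg (a ord0 m) *: unit_vec m.
have a'E j : a' ord0 j = if j == m then a ord0 m - Num.sg (a ord0 m) else a ord0 j.
  rewrite !mxE eqxx /=; case: eqVneq => [->|_]; first by rewrite mulr1.
  by rewrite mulr0 subr0.
have absE : `|a ord0 m|%N = `|a ord0 m - Num.sg (a ord0 m)|%N.+1.
  case: (ltrgtP (a ord0 m) 0) am => // a0' _; rewrite ?(ltr0_sg a0') ?(gtr0_sg a0').
    by move: a0'; case: (a ord0 m) => // n _; rewrite opprK; lia.
  by move: a0'; case: (a ord0 m) => // n; lia.
exists m, a'; split; last split.
- rewrite /norm1 (bigD1 m)//= [in RHS](bigD1 m)//= a'E eqxx absE addSn.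
  by congr (_ + _).+1; apply: eq_bigr => j /negbTE jm; rewrite a'E jm.
- by move=> j; rewrite a'E; case: eqVneq => [->|//]; rewrite absE.
- case: (ltrgtP (a ord0 m) 0) am => // a0' _; [right|left].
    by rewrite /a' (ltr0_sg a0') scaleN1r opprK.
  by rewrite /a' (gtr0_sg a0') scale1r subrK.
Qed.

(** The triangle inequality in l^2(s) along the walk from p to p + a: each of the [norm1 a] unit
    steps costs at most E in squared norm. The hypothesis on [s] keeps all intermediate points in
    D. *)
Lemma translation_estimate v (D : set 'rV[int]_d) (E : R) (n : nat)
    (s : seq 'rV[int]_d) (a : 'rV[int]_d) :
  (forall m t, uniq t -> {in t, forall p, D p /\ D (p + unit_vec m)} ->
    \sum_(p <- t) (v (p + unit_vec m) - v p) ^+ 2 <= E) ->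
  uniq s ->
  {in s, forall p b, (forall m, `|b ord0 m| <= n)%N -> D (p + b)} ->
  (forall m, `|a ord0 m| <= n)%N ->
  \sum_(p <- s) (v (p + a) - v p) ^+ 2 <= (norm1 a)%:R ^+ 2 * E.
Proof.
move=> HE us sD.
(* The sign of E comes from the empty list, but only once a direction m exists; for d = 0 nothing is
   known about it. *)
have E0 (m : 'I_d) : 0 <= E by have := HE m [::] isT; rewrite big_nil; apply.
move aN : (norm1 a) => N; elim: N a aN => [|N IHN] a aN an.
  rewrite expr0n mul0r big1// => p _.
  suff -> : a = 0 by rewrite addr0 subrr expr0n.
  apply/rowP => m; rewrite mxE; apply/eqP; rewrite -absz_eq0.
  by move/eqP: aN; rewrite sum_nat_eq0 => /forallP/(_ m).
have a0 : a != 0.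
  by apply: contra_eq_neq aN => ->; rewrite /norm1 big1// => m _; rewrite mxE.
have [m [a' [a1 [a'n step]]]] := norm1_step a0.
have {}a1 : norm1 a' = N by move: a1; rewrite aN => -[].
have {}a'n j : (`|a' ord0 j| <= n)%N by exact: leq_trans (a'n j) (an j).
have {}IHN := IHN _ a1 a'n.
have inj b : injective (fun p => p + b) by exact: addIr.
have last_step : \sum_(p <- s) (v (p + a) - v (p + a')) ^+ 2 <= E.
  case: step => [aE|a'E].
    apply: le_trans (HE m (map (fun p => p + a') s) _ _).
  - rewrite big_map le_eqVlt; apply/orP; left; apply/eqP.
    by apply: eq_bigr => p _; rewrite aE addrA.
  - by rewrite map_inj_uniq//; exact: inj.
  - move=> _ /mapP[p ps ->]; split; first exact: sD.
    by rewrite -addrA -aE; exact: sD.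
  apply: le_trans (HE m (map (fun p => p + a) s) _ _).
  - rewrite big_map le_eqVlt; apply/orP; left; apply/eqP.
    by apply: eq_bigr => p _; rewrite a'E addrA -sqrrN opprB.
  - by rewrite map_inj_uniq//; exact: inj.
  - move=> _ /mapP[p ps ->]; split; first exact: sD.
    by rewrite -addrA -a'E; exact: sD.
(* With no earlier step the weight 1/N below is meaningless; instead v (p + a') = v p on s, and the
   last step is the whole sum. *)
case: N IHN {aN a1} => [|N] IHN.
  rewrite expr1n mul1r; apply: le_trans last_step.
  have a'0 : \sum_(p <- s) (v (p + a') - v p) ^+ 2 = 0.
    apply/eqP; rewrite eq_le sumr_ge0 ?andbT => [|p _]; last exact: sqr_ge0.
    by move: IHN; rewrite expr0n mul0r.
  apply: (@le_trans _ _ (\sum_(p <- s) ((v (p + a) - v (p + a')) ^+ 2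
     + 2 * (v (p + a) - v (p + a')) * (v (p + a') - v p) + (v (p + a') - v p) ^+ 2))).
    by apply: ler_sum => p _; rewrite le_eqVlt; apply/orP; left; apply/eqP; ring.
  rewrite !big_split/= a'0 addr0 [X in _ + X]big_seq [X in _ + X]big1 ?addr0// => p ps.
  have /allP/(_ p ps)/= : all (fun p => (v (p + a') - v p) ^+ 2 == 0) s.
    by move/eqP: a'0; rewrite psumr_eq0// => p' _; exact: sqr_ge0.
  by rewrite sqrf_eq0 => /eqP ->; rewrite mulr0.
have N0 : 0 < N.+1%:R :> R by [].
(* With M = N + 1, (x + y)^2 <= (1 + 1/M) x^2 + (M + 1) y^2. These weights are sharp for the
   induction: (1 + 1/M) M^2 + (M + 1) = (M + 1)^2. *)
apply: (@le_trans _ _ (\sum_(p <- s) ((1 + N.+1%:R^-1) * (v (p + a') - v p) ^+ 2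
    + N.+2%:R * (v (p + a) - v (p + a')) ^+ 2))).
  apply: ler_sum => p _.
  rewrite (_ : v (p + a) - v p = (v (p + a') - v p) + (v (p + a) - v (p + a'))); last ring.
  rewrite -(natr1 N.+1); move: (v (p + a') - v p) (v (p + a) - v (p + a')) => x y.
  move: (N.+1%:R) N0 => M M0; rewrite -subr_ge0.
  rewrite [leRHS](_ : _ = M^-1 * (x - M * y) ^+ 2); last by field; rewrite gt_eqF.
  by rewrite mulr_ge0 ?sqr_ge0// invr_ge0 ltW.
rewrite big_split/= -!mulr_sumr.
have E0m := E0 m.
have c0 : 0 <= 1 + N.+1%:R^-1 :> R by rewrite addr_ge0// invr_ge0 ltW.
have c1 : 0 <= N.+2%:R :> R by [].
apply: le_trans (lerD (ler_wpM2l c0 IHN) (ler_wpM2l c1 last_step)) _.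
rewrite le_eqVlt; apply/orP; left; apply/eqP.
by rewrite -(natr1 N.+1); field; rewrite gt_eqF.
Qed.

Definition lattice_box (n : nat) : seq 'rV[int]_d :=
  [seq \row_m ((f m : nat)%:Z - n%:Z) | f : {ffun 'I_d -> 'I_(n.*2.+1)}].

Lemma lattice_box_uniq n : uniq (lattice_box n).
Proof.
rewrite map_inj_uniq ?enum_uniq// => f g fg; apply/ffunP => m; apply/val_inj.
by move/rowP/(_ m): fg; rewrite !mxE => /addIr [].
Qed.

Lemma size_lattice_box n : size (lattice_box n) = (n.*2.+1 ^ d)%N.
Proof. by rewrite size_map -cardT card_ffun !card_ord. Qed.

Lemma mem_lattice_box n b :
  (b \in lattice_box n) <-> (forall m, `|b ord0 m| <= n)%N.
Proof.
split => [/mapP[f _ -> m]|bn].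
  by rewrite mxE; have := ltn_ord (f m); move: (nat_of_ord (f m)) => i; rewrite -muln2; lia.
have bm m : (`|(b ord0 m + n%:Z)%R| < n.*2.+1)%N by have := bn m; lia.
apply/mapP; exists [ffun m => Ordinal (bm m)]; first by rewrite mem_enum.
apply/rowP => m; rewrite mxE ffunE /=; have := bn m.
by move: (b ord0 m) => z; lia.
Qed.

(* Since the weights of l add up to at most W, a pair (l, l') carries at most W^2
   in total, however many coarse cells q meet both l and l'. *)
Lemma weighted_poincare (I : eqType) (F : seq I) (L : seq 'rV[int]_d)
    (w : I -> 'rV[int]_d -> R) v (n : nat) (V W K : R) :
  uniq L -> 0 < V -> (forall q l, 0 <= w q l) ->
  {in L, forall l, \sum_(q <- F) w q l <= W} ->
  {in F, forall q, \sum_(l <- L) w q l = V} ->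
  (forall q l l', w q l != 0 -> w q l' != 0 ->
     forall m, (`|(l' - l)%R ord0 m| <= n)%N) ->
  (forall a, (forall m, `|a ord0 m| <= n)%N ->
     \sum_(l <- L) (v (l + a) - v l) ^+ 2 <= K) ->
  \sum_(q <- F) \sum_(l <- L) w q l * (v l - V^-1 * \sum_(j <- L) w q j * v j) ^+ 2
  <= (2 * V)^-1 * (W ^+ 2 * (n.*2.+1 ^ d)%:R * K).
Proof.
move=> uL V0 w0 wW wV wn vK.
rewrite big_seq; under eq_bigr => q qF.
  rewrite weighted_variance ?gt_eqF//; last exact: wV.
  over.
rewrite -big_seq -mulr_sumr ler_wpM2l ?invr_ge0 ?mulr_ge0 ?(ltW V0)//.
rewrite exchange_big/=; under eq_bigr => l _ do rewrite exchange_big/=.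
have wwW : {in L &, forall l l', \sum_(q <- F) w q l * w q l' <= W ^+ 2}.
  move=> l l' lL l'L.
  have wl' q : q \in F -> w q l' <= W.
    move=> qF; apply: le_trans (wW _ l'L); rewrite (big_rem q)//= lerDl.
    by rewrite sumr_ge0.
  apply: (@le_trans _ _ (\sum_(q <- F) w q l * W)).
    by rewrite big_seq [leRHS]big_seq; apply: ler_sum => q qF; rewrite ler_wpM2l ?wl'.
  rewrite -mulr_suml expr2 ler_wpM2r//; last exact: wW.
  by apply: le_trans (wW _ lL); rewrite sumr_ge0.
(* For fixed l the substitution l' = l + b is injective into [lattice_box n], so the pair sum is
   dominated by (2n+1)^d translation sums, each at most K. *)
apply: (@le_trans _ _ (\sum_(l <- L) \sum_(b <- lattice_box n)
    W ^+ 2 * (v (l + b) - v l) ^+ 2)).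
  rewrite big_seq [leRHS]big_seq; apply: ler_sum => l lL.
  have term l' : l' \in L ->
      \sum_(q <- F) w q l * w q l' * (v l' - v l) ^+ 2 <=
      if l' - l \in lattice_box n then W ^+ 2 * (v (l + (l' - l)) - v l) ^+ 2 else 0.
    move=> l'L; rewrite -mulr_suml (addrC l) subrK; case: ifPn => [_|/negP ln].
      by rewrite ler_wpM2r ?sqr_ge0 ?wwW.
    rewrite big1 ?mul0r// => q _; apply/eqP; rewrite mulf_eq0; apply: contrapT.
    move=> /negP; rewrite negb_or => /andP[wl wl']; apply: ln.
    by apply/mem_lattice_box; exact: wn wl wl'.
  apply: (@le_trans _ _ (\sum_(l' <- L | l' - l \in lattice_box n)
      W ^+ 2 * (v (l + (l' - l)) - v l) ^+ 2)).
    by rewrite [leRHS]big_mkcond big_seq [leRHS]big_seq; apply: ler_sum.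
  rewrite -big_filter.
  apply: (ler_sum_inj (f := fun l' => l' - l)
    (G := fun b => W ^+ 2 * (v (l + b) - v l) ^+ 2)).
  - exact: filter_uniq.
  - exact: lattice_box_uniq.
  - by move=> x y _ _ /addIr.
  - by move=> x; rewrite mem_filter => /andP[].
  - by move=> y; rewrite mulr_ge0// sqr_ge0.
rewrite exchange_big/=.
apply: (@le_trans _ _ (\sum_(b <- lattice_box n) W ^+ 2 * K)).
  rewrite big_seq [leRHS]big_seq; apply: ler_sum => b /mem_lattice_box bn.
  by rewrite -mulr_sumr ler_wpM2l ?sqr_ge0// vK.
by rewrite big_const_seq count_predT size_lattice_box iter_addr_0 -mulr_natr; lra.
Qed.

End lattice_steps.

(** * Overlaps of two cubical grids *)

Section cells_bounded.
Context {R : realType} {d : nat}.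
Implicit Types (x y : 'rV[R]_d) (h B : R) (l q : 'rV[int]_d).
Local Notation mu := (@lebesgue_rV R d).

Definition grid_point h l : 'rV[R]_d := \row_m (h * (l ord0 m)%:~R).

Lemma grid_pointE h l m : grid_point h l ord0 m = h * (l ord0 m)%:~R.
Proof. by rewrite mxE. Qed.

Lemma cell_of_bounded B h : 0 < h ->
  exists n, forall x, ball 0 B x -> cell_of h x \in lattice_box n.
Proof.
move=> h0; exists (Num.truncn (B / h)).+1 => x [B0 xB]; apply/mem_lattice_box => m.
have /andP[lx xl] := cell_ofP x m h0.
have := xB ord0 m; rewrite /ball /= mxE sub0r normrN ltr_norml => /andP[Bx xB'].
have /andP[_ Bt] := truncn_itv (ltW (divr_gt0 B0 h0)).
rewrite -ltnS -(ltr_nat R) natr_absz intr_norm -natr1.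
move: Bt; rewrite ltr_pdivrMr// => Bt.
move: lx xl; move: (_%:~R) => z lx xl; rewrite -(ltr_pM2l h0).
rewrite -[X in X * `|_|](gtr0_norm h0) -normrM mulrDr mulr1.
by move: Bt; move: (_%:R) => t; rewrite ltr_norml => Bt; apply/andP; split; lra.
Qed.

Lemma measure_partition (I : countType) (phi : 'rV[R]_d -> I) (s : seq I) :
  (forall i, measurable (phi @^-1` [set i])) -> uniq s ->
  mu [set x | phi x \in s] = (\sum_(i <- s) mu (phi @^-1` [set i]))%E.
Proof.
move=> mphi us; have := @ge0_integral_partition _ _ _ mu _ _ mphi _ (fun=> 1%E) us (fun=> lee01).
rewrite integral_cst ?mul1e; last exact: (measurable_preimage_countable mphi [set` s]).
by move=> ->; apply: eq_bigr => i _; rewrite mul1e.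
Qed.

(** The weight with which a fine cell counts for a coarse one. Passing to a real loses nothing for
    positive sides, cells having finite measure. *)
Definition overlap h h' q l : R := fine (mu (grid_cell h q `&` grid_cell h' l)).

Lemma measurable_overlap h h' q l : 0 < h -> 0 < h' ->
  measurable (grid_cell h q `&` grid_cell h' l).
Proof. by move=> h0 h'0; apply: measurableI; exact: measurable_grid_cell. Qed.

Lemma overlapE h h' q l : 0 < h -> 0 < h' ->
  mu (grid_cell h q `&` grid_cell h' l) = (overlap h h' q l)%:E.
Proof.
move=> h0 h'0; rewrite /overlap fineK// ge0_fin_numE//.
apply: (@le_lt_trans _ _ (mu (grid_cell h q))).
  apply: le_measure; rewrite ?inE; [exact: measurable_overlap|exact: measurable_grid_cell|].
  exact: subIsetl.
by rewrite lebesgue_grid_cell// ltry.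
Qed.

Lemma overlap_ge0 h h' q l : 0 <= overlap h h' q l.
Proof. exact: fine_ge0. Qed.

Lemma overlap_neq0 h h' q l : overlap h h' q l != 0 ->
  exists2 x, cell_of h x = q & cell_of h' x = l.
Proof.
move=> w0; apply: contrapT => h0; case/eqP: w0; rewrite /overlap.
rewrite (_ : _ `&` _ = set0) ?measure0//; apply/seteqP; split => // x [xq xl].
by apply: h0; exists x.
Qed.

Let two_cells h h' x := (cell_of h x, cell_of h' x).

Let two_cellsE h h' q l :
  two_cells h h' @^-1` [set (q, l)] = grid_cell h q `&` grid_cell h' l.
Proof.
by apply/seteqP; split => x; rewrite /two_cells /grid_cell /= => -[-> ->].
Qed.

Let measurable_two_cells h h' : 0 < h -> 0 < h' ->
  forall ql, measurable (two_cells h h' @^-1` [set ql]).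
Proof. by move=> h0 h'0 [q l]; rewrite two_cellsE; exact: measurable_overlap. Qed.

Lemma overlap_sum_fine h h' q (L : seq 'rV[int]_d) : 0 < h -> 0 < h' -> uniq L ->
  (forall x, cell_of h x = q -> cell_of h' x \in L) ->
  \sum_(l <- L) overlap h h' q l = h ^+ d.
Proof.
move=> h0 h'0 uL qL; apply: EFin_inj; rewrite -sumEFin -(lebesgue_grid_cell q h0).
have us : uniq [seq (q, l) | l <- L] by rewrite map_inj_uniq// => l l' [].
have := measure_partition (measurable_two_cells h0 h'0) us.
rewrite big_map => /esym; under eq_bigr => l _ do rewrite two_cellsE overlapE//.
move=> ->; congr (mu _); apply/seteqP; split => x /=.
  by move=> /mapP[l _ [<- _]].
by move=> xq; apply/mapP; exists (cell_of h' x); [exact: qL|rewrite /two_cells xq].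
Qed.

Lemma overlap_sum_coarse h h' l (F : seq 'rV[int]_d) : 0 < h -> 0 < h' -> uniq F ->
  \sum_(q <- F) overlap h h' q l <= h' ^+ d.
Proof.
move=> h0 h'0 uF; rewrite -lee_fin -sumEFin -(lebesgue_grid_cell l h'0).
have us : uniq [seq (q, l) | q <- F] by rewrite map_inj_uniq// => q q' [].
have := measure_partition (measurable_two_cells h0 h'0) us.
rewrite big_map => /esym; under eq_bigr => q _ do rewrite two_cellsE overlapE//.
move=> ->; apply: le_measure; rewrite ?inE.
- exact: (measurable_preimage_countable (measurable_two_cells h0 h'0)
    [set` [seq (q, l) | q <- F]]).
- exact: measurable_grid_cell.
- by move=> x /= /mapP[q _ [_ <-]].
Qed.

Lemma sqint_two_cells (D : set 'rV[R]_d) h h' (F L : seq 'rV[int]_d)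
    (G : 'rV[int]_d -> 'rV[int]_d -> R) :
  0 < h -> 0 < h' -> uniq F -> uniq L -> measurable D ->
  (forall x, D x -> cell_of h x \in F /\ cell_of h' x \in L) ->
  (sqint mu D (fun x => G (cell_of h x) (cell_of h' x)) <=
   (\sum_(q <- F) \sum_(l <- L) overlap h h' q l * G q l ^+ 2)%:E)%E.
Proof.
move=> h0 h'0 uF uL mD DFL.
have us : uniq [seq (q, l) | q <- F, l <- L].
  by apply: allpairs_uniq => // -[a b] [a' b'].
have mphi := measurable_two_cells h0 h'0.
have G0 (ql : 'rV[int]_d * 'rV[int]_d) : (0 <= (G ql.1 ql.2 ^+ 2)%:E)%E.
  by rewrite lee_fin sqr_ge0.
have E := ge0_integral_partition mu mphi us G0.
apply: (@le_trans _ _ (sqint mu [set x | two_cells h h' x \in [seq (q, l) | q <- F, l <- L]]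
    (fun x => G (cell_of h x) (cell_of h' x)))).
  apply: sub_sqint => //.
  - exact: (measurable_preimage_countable mphi [set` _]).
  - exact: (@measurable_fun_countable _ _ _ _ mphi _ _ (fun ql => G ql.1 ql.2)).
  - by move=> x /DFL[xF xL] /=; apply/allpairsP; exists (two_cells h h' x).
rewrite /sqint E big_allpairs -sumEFin; apply: lee_sum => q _.
rewrite -sumEFin; apply: lee_sum => l _.
by rewrite two_cellsE overlapE// -EFinM mulrC.
Qed.

End cells_bounded.

Lemma interval_dist (R : realFieldType) (a b c h dl y y' : R) : dl < c * h ->
  `|y - y'| < dl -> b <= y' -> y' < b + h -> a <= y -> y < a + h ->
  `|b - a| < h * c + h.
Proof. by rewrite !ltr_norml => ? /andP[? ?] ? ? ? ?; apply/andP; split; lra. Qed.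

(** One coordinate of the claim that a walk stays deep: x is the given point, y shares its coarse
    cell, a is the corner of the fine cell of y, b the displacement, z a point near the displaced
    corner. The four distances add up to dl + h + (dl + h) + kappa h. *)
Lemma deep_dist (R : realFieldType) (a b x y z h dl kappa rho : R) :
  2 * dl + (2 + kappa) * h <= rho -> `|b| <= dl + h -> `|x - y| < dl ->
  `|a - y| <= h -> `|a + b - z| < kappa * h -> `|x - z| < rho.
Proof.
rewrite !ltr_norml !ler_norml => ? /andP[? ?] /andP[? ?] /andP[? ?] /andP[? ?].
by apply/andP; split; lra.
Qed.

Section oscillation.
Context {R : realType} {d : nat}.
Implicit Types (x y : 'rV[R]_d) (l q : 'rV[int]_d) (v : 'rV[int]_d -> R).
Local Notation mu := (@lebesgue_rV R d).
Local Notation unit_vec m := (delta_mx ord0 m : 'rV[int]_d).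

(** The average over a coarse cell of the step function with values v. The sum over the whole
    lattice has finite support, as only fine cells meeting the coarse one carry weight, and it
    commits to no particular list. *)
Definition coarse_mean (dl h : R) v q : R :=
  dl ^- d * \sum_(l \in [set: 'rV[int]_d]) overlap dl h q l * v l.

Lemma coarse_meanE (dl h : R) v q (L : seq 'rV[int]_d) : uniq L ->
  (forall x, cell_of dl x = q -> cell_of h x \in L) ->
  coarse_mean dl h v q = (dl ^+ d)^-1 * \sum_(l <- L) overlap dl h q l * v l.
Proof.
move=> uL qL; congr (_ * _); rewrite (@fsbigE _ _ _ _ _ L)//.
  by apply: eq_bigl => l; rewrite in_setT.
move=> l _ lL; have [->|/overlap_neq0[x xq xl]] := eqVneq (overlap dl h q l) 0.
  by rewrite mul0r.
by move: lL; rewrite -xl qL.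
Qed.

(** Jensen's inequality, read off from the nonnegativity of a weighted variance. It serves to bound
    the means uniformly in h at a fixed scale dl, so the factor dl^-d is harmless. *)
Lemma sqr_coarse_mean_le (dl h : R) v q (C : R) : 0 < dl -> 0 < h ->
  (forall s, uniq s -> h ^+ d * \sum_(l <- s) v l ^+ 2 <= C) ->
  coarse_mean dl h v q ^+ 2 <= dl ^- d * C.
Proof.
move=> dl0 h0 vC.
have [n nP] := @cell_of_bounded R d (dl * (\sum_m `|(q ord0 m)%:~R|) + 2 * dl) h h0.
have uL := @lattice_box_uniq d n.
have qL x : cell_of dl x = q -> cell_of h x \in lattice_box n.
  move=> xq; apply: nP; apply/ballP => [|m].
    by rewrite ltr_wpDl ?mulr_gt0// mulr_ge0 ?(ltW dl0)// sumr_ge0.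
  rewrite mxE sub0r normrN; have := cell_ofP x m dl0; rewrite xq => /andP[x1 x2].
  have qm : `|(q ord0 m)%:~R| <= \sum_m `|(q ord0 m)%:~R| :> R.
    by rewrite (bigD1 m)//= lerDl sumr_ge0.
  rewrite -(ler_pM2l dl0) -{1}(gtr0_norm dl0) -normrM in qm.
  move: qm; rewrite ler_norml => /andP[q1 q2].
  by rewrite ltr_norml; apply/andP; split; lra.
rewrite (coarse_meanE v uL qL).
set c := (_ * _); set V := dl ^+ d; set w := overlap dl h q.
have V0 : 0 < V by rewrite exprn_gt0.
have wV : \sum_(l <- lattice_box n) w l = V by exact: overlap_sum_fine.
have cE : \sum_(l <- lattice_box n) w l * v l = V * c.
  by rewrite mulrA mulfV ?gt_eqF// mul1r.
have : 0 <= \sum_(l <- lattice_box n) w l * (v l - c) ^+ 2.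
  by apply: sumr_ge0 => l _; rewrite mulr_ge0 ?sqr_ge0 ?overlap_ge0.
rewrite (_ : \sum_(l <- _) _ = \sum_(l <- lattice_box n)
    (w l * v l ^+ 2 - 2 * c * (w l * v l) + c ^+ 2 * w l)); last first.
  by apply: eq_bigr => l _; ring.
rewrite big_split/= sumrB -!mulr_sumr cE wV => vc.
rewrite ler_pdivlMl//.
have : \sum_(l <- lattice_box n) w l * v l ^+ 2 <= C.
  apply: le_trans (vC _ uL); rewrite mulr_sumr; apply: ler_sum => l _.
  rewrite ler_wpM2r ?sqr_ge0//.
  by have := overlap_sum_coarse l dl0 h0 (isT : uniq [:: q]); rewrite big_seq1.
by move: vc; rewrite -/V; lra.
Qed.

Lemma sqint_cells_le (D : set 'rV[R]_d) (B h : R) v (C : R) : 0 < h ->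
  measurable D -> D `<=` ball 0 B ->
  (forall s, uniq s -> h ^+ d * \sum_(l <- s) v l ^+ 2 <= C) ->
  (sqint mu D (v \o cell_of h) <= C%:E)%E.
Proof.
move=> h0 mD DB vC; have [n nP] := @cell_of_bounded R d B h h0.
have mphi l := @measurable_grid_cell R d h l h0.
apply: (@le_trans _ _ (sqint mu [set x | cell_of h x \in lattice_box n] (v \o cell_of h))).
  apply: sub_sqint => //.
  - exact: (measurable_preimage_countable mphi [set` _]).
  - exact: (measurable_fun_countable mphi).
  - by move=> x /DB /nP.
have v0 l : (0 <= (v l ^+ 2)%:E)%E by rewrite lee_fin sqr_ge0.
rewrite /sqint/= (ge0_integral_partition mu mphi (@lattice_box_uniq d n) v0).
apply: le_trans (_ : (h ^+ d * \sum_(l <- lattice_box n) v l ^+ 2)%:E <= _)%E; last first.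
  by rewrite lee_fin vC// lattice_box_uniq.
rewrite mulr_sumr -sumEFin; apply: lee_sum => l _.
by rewrite [X in (_ * X)%E](@lebesgue_grid_cell R d h l h0) -EFinM mulrC.
Qed.

(** A substitute for [deep_cells] that does not mention the boundary: it is checked by inclusion of
    balls, and for kappa = [deep_width] it implies [deep_cells]. *)
Definition deep (Om : set 'rV[R]_d) (kappa h : R) : set 'rV[int]_d :=
  [set l | ball (grid_point h l) (kappa * h) `<=` Om].

Lemma grid_point_cell h x m : 0 < h ->
  `|grid_point h (cell_of h x) ord0 m - x ord0 m| <= h.
Proof.
move=> h0; have /andP[] := cell_ofP x m h0; rewrite grid_pointE ler_norml => ? ?.
by apply/andP; split; lra.
Qed.

(** The Poincare inequality at scale dl. The radius rho pays for two points in one coarse cell, the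
    length of the walk and the width of a deep cell; neither h nor B enters the constant. *)
Lemma sqint_oscillation (Om D : set 'rV[R]_d) (B dl h kappa rho C : R) v :
  0 < h -> h <= dl -> 0 < kappa -> 2 * dl + (2 + kappa) * h <= rho ->
  measurable D -> D `<=` ball 0 B -> (forall x, D x -> ball x rho `<=` Om) ->
  (forall m t, uniq t ->
     {in t, forall p, deep Om kappa h p /\ deep Om kappa h (p + unit_vec m)} ->
     h ^+ d * \sum_(p <- t) (v (p + unit_vec m) - v p) ^+ 2 <= C * h ^+ 2) ->
  (sqint mu D (fun x => v (cell_of h x) - coarse_mean dl h v (cell_of dl x))%R
    <= (2 * 5 ^+ d * d%:R ^+ 2 * C * dl ^+ 2)%:E)%E.
Proof.
move=> h0 hdl k0 rhoP mD DB DOm vC.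
have dl0 : 0 < dl by exact: lt_le_trans hdl.
have [N1 N1P] := @cell_of_bounded R d B dl dl0.
have [N2 N2P] := @cell_of_bounded R d (B + dl) h h0.
(* F keeps only coarse cells that meet D, and L only fine cells that meet a cell of F: each l in L
   is then close to a point of D, which has room rho inside Om. *)
pose F := [seq q <- lattice_box N1 | `[< exists2 x, D x & cell_of dl x = q >]].
pose L := [seq l <- lattice_box N2 | `[< exists2 y, cell_of dl y \in F & cell_of h y = l >]].
have uF : uniq F by rewrite filter_uniq// lattice_box_uniq.
have uL : uniq L by rewrite filter_uniq// lattice_box_uniq.
have FP q : q \in F -> exists2 x, D x & cell_of dl x = q.
  by rewrite mem_filter => /andP[/asboolP].
have LP l : l \in L -> exists2 y, cell_of dl y \in F & cell_of h y = l.
  by rewrite mem_filter => /andP[/asboolP].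
have DF x : D x -> cell_of dl x \in F.
  by move=> Dx; rewrite mem_filter N1P ?andbT; [apply/asboolP; exists x|exact: DB].
have FL y : cell_of dl y \in F -> cell_of h y \in L.
  move=> yF; rewrite mem_filter; apply/andP; split; first by apply/asboolP; exists y.
  have [x Dx xy] := FP _ yF; apply: N2P; apply: ball_triangle (DB _ Dx) _.
  by apply/ballP => // m; exact: cell_of_dist.
apply: (le_trans (@sqint_two_cells R d D dl h F L
    (fun q l => v l - coarse_mean dl h v q)%R dl0 h0 uF uL mD _)).
  by move=> x Dx; split; [exact: DF|exact/FL/DF].
rewrite lee_fin.
(* The least n with dl < n h: two fine cells meeting one coarse cell differ by at most n in each
   coordinate, while n h <= dl + h <= 2 dl. *)
set t := Num.truncn (dl / h); pose n := t.+1.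
have /andP[t1 t2] : t%:R <= dl / h < t.+1%:R by apply: truncn_itv; rewrite divr_ge0 ?ltW.
have nh : n%:R * h <= dl + h.
  by move: t1; rewrite ler_pdivlMr// /n -natr1; lra.
have nh2 : n%:R * h <= 2 * dl by apply: le_trans nh _; lra.
have dnh : dl < n%:R * h by move: t2; rewrite ltr_pdivrMr.
clearbody n; have V0 : 0 < dl ^+ d by rewrite exprn_gt0.
have W0 : 0 < h ^+ d by rewrite exprn_gt0.
have C0 (m : 'I_d) : 0 <= C.
  have := vC m [::] isT; rewrite big_nil mulr0 => /(_ _)/=.
  by rewrite pmulr_lge0 ?exprn_gt0//; apply.
have absz_lt (z : int) : `|z%:~R : R| < n%:R + 1 -> (`|z| <= n)%N.
  by rewrite -ltnS -(ltr_nat R) natr_absz intr_norm -natr1.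
have wn q l l' : overlap dl h q l != 0 -> overlap dl h q l' != 0 ->
    forall m, (`|(l' - l)%R ord0 m| <= n)%N.
  move=> /overlap_neq0[y yq yl] /overlap_neq0[y' y'q y'l] m; apply: absz_lt.
  rewrite !mxE intrB -(ltr_pM2l h0) -[X in X * `|_|](gtr0_norm h0) -normrM mulrBr mulrDr mulr1.
  have /andP[] := cell_ofP y m h0; have /andP[] := cell_ofP y' m h0.
  have := @cell_of_dist R d dl y y' m dl0; rewrite yq y'q => /(_ erefl).
  rewrite yl y'l => yy' y1 y2 y'1 y'2; apply: interval_dist dnh yy' y1 y2 y'1 y'2.
have vK (a : 'rV[int]_d) : (forall m, (`|a ord0 m| <= n)%N) ->
    \sum_(l <- L) (v (l + a) - v l) ^+ 2 <= (d * n)%:R ^+ 2 * (C * h ^+ 2 / h ^+ d).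
  move=> an; have := @translation_estimate R d v (deep Om kappa h) (C * h ^+ 2 / h ^+ d) n L a.
  move=> /(_ _ uL _ an) h'; apply: le_trans (h' _ _) _.
  - by move=> m s us sD; rewrite ler_pdivlMr// mulrC; exact: vC.
  - move=> l /LP[y /FP[x Dx xy] yl] b bn.
    apply: subset_trans (DOm _ Dx); rewrite /deep => z /ballP zP.
    have {}zP := zP (mulr_gt0 k0 h0).
    apply/ballP => [|m]; first by apply: lt_le_trans rhoP; rewrite addr_gt0 ?mulr_gt0 ?addr_gt0.
    have := zP m; rewrite grid_pointE mxE intrD mulrDr.
    have := grid_point_cell y m h0; rewrite grid_pointE yl.
    have := @cell_of_dist R d dl x y m dl0 xy.
    have : h * `|(b ord0 m)%:~R| <= dl + h.
      apply: le_trans nh; rewrite mulrC ler_wpM2r ?(ltW h0)//.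
      by rewrite -intr_norm -natr_absz ler_nat.
    rewrite -[X in X * `|_|](gtr0_norm h0) -normrM.
    by move=> hb xy' hy zb; apply: deep_dist rhoP hb xy' hy zb.
  - have na : (norm1 a <= d * n)%N.
      rewrite -[in leqRHS](card_ord d) -sum_nat_const.
      by apply: leq_sum => m _; exact: an.
    have [d0|d0] := posnP d.
      have dn0 : (d * n = 0)%N by rewrite d0.
      by move: na; rewrite dn0 leqn0 => /eqP ->.
    rewrite ler_wpM2r//.
      by rewrite divr_ge0 ?mulr_ge0 ?sqr_ge0 ?(C0 (Ordinal d0))// ltW.
    by rewrite lerXn2r ?nnegrE ?ler0n// ler_nat.
have := @weighted_poincare R d _ F L (overlap dl h) v n (dl ^+ d) (h ^+ d)
  ((d * n)%:R ^+ 2 * (C * h ^+ 2 / h ^+ d)) uL V0 (@overlap_ge0 R d dl h) _ _ wn vK.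
move=> h'.
have {}h' : \sum_(q <- F) \sum_(l <- L) overlap dl h q l *
     (v l - (dl ^+ d)^-1 * (\sum_(j <- L) overlap dl h q j * v j)) ^+ 2 <=
     (2 * dl ^+ d)^-1 * ((h ^+ d) ^+ 2 * (n.*2.+1 ^ d)%:R *
     ((d * n)%:R ^+ 2 * (C * h ^+ 2 / h ^+ d))).
  apply: h'.
  - by move=> l _; exact: overlap_sum_coarse.
  - by move=> q qF; apply: overlap_sum_fine => // x xq; apply: FL; rewrite xq.
rewrite big_seq; under eq_bigr => q qF.
  rewrite (@coarse_meanE dl h v q L uL); last by move=> x xq; apply: FL; rewrite xq.
  over.
rewrite -big_seq; apply: le_trans h' _.
(* Powers of h are regrouped with n: (h (2n+1))^d <= (5 dl)^d counts the translations and (n h)^2 <=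
   (2 dl)^2 their length. This yields 5^d and, with the 1/2 of the variance, the factor 2. *)
have -> : (2 * dl ^+ d)^-1 * ((h ^+ d) ^+ 2 * (n.*2.+1 ^ d)%:R *
     ((d * n)%:R ^+ 2 * (C * h ^+ 2 / h ^+ d))) =
   (2 * dl ^+ d)^-1 * d%:R ^+ 2 * C * ((h * n.*2.+1%:R) ^+ d * (n%:R * h) ^+ 2).
  by rewrite natrM natrX !exprMn; field; rewrite !gt_eqF.
have [d0|d0] := posnP d.
  by rewrite d0 !expr0n /= !(mulr0, mul0r).
have {}C0 := C0 (Ordinal d0).
have -> : 2 * 5 ^+ d * d%:R ^+ 2 * C * dl ^+ 2 =
  (2 * dl ^+ d)^-1 * d%:R ^+ 2 * C * ((5 * dl) ^+ d * (2 * dl) ^+ 2).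
  by rewrite !exprMn; field; rewrite !gt_eqF.
apply: ler_wpM2l.
  by rewrite !mulr_ge0 ?sqr_ge0// invr_ge0 mulr_ge0// ltW.
apply: ler_pM.
- by rewrite exprn_ge0// mulr_ge0// ltW.
- exact: sqr_ge0.
- rewrite lerXn2r ?nnegrE ?mulr_ge0 ?(ltW h0) ?(ltW dl0)//.
  by rewrite -natr1 -muln2 natrM; lra.
- by rewrite lerXn2r ?nnegrE ?mulr_ge0 ?(ltW h0) ?(ltW dl0).
Qed.

End oscillation.

(** * Strong compactness *)

Section exhaustion.
Context {R : realType} {d : nat}.
Implicit Types (x y : 'rV[R]_d) (Om S : set 'rV[R]_d).
Local Notation mu := (@lebesgue_rV R d).

(** An exhaustion of Om whose margin 1/(i+1) plays the part of rho in [sqint_oscillation]. *)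
Definition inner_set Om (i : nat) : set 'rV[R]_d :=
  [set x | ball 0 i.+1%:R x /\ ball x i.+1%:R^-1 `<=` Om].

Lemma measurable_inner_set Om i : measurable (inner_set Om i).
Proof.
have -> : inner_set Om i = ball 0 i.+1%:R `\`
    \bigcup_(y in ~` Om) ball y i.+1%:R^-1.
  apply/seteqP; split => [x [xi xOm]|x [xi xOm]]; split => //.
    by move=> [y yOm /ball_sym yx]; apply: yOm; exact: xOm.
  move=> y xy; apply: contrapT => yOm; apply: xOm; exists y => //.
  exact: ball_sym.
apply: measurableD; apply: measurable_open; first exact: ball_open.
by apply: bigcup_open => y _; apply: ball_open; rewrite invr_gt0.
Qed.

Lemma inner_set_ball Om i : inner_set Om i `<=` ball 0 i.+1%:R.
Proof. by move=> x []. Qed.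

Lemma inner_set_sub Om i : inner_set Om i `<=` Om.
Proof. by move=> x [_]; apply; apply: ballxx; rewrite invr_gt0. Qed.

Lemma inner_set_mono Om i i' : (i <= i')%N -> inner_set Om i `<=` inner_set Om i'.
Proof.
move=> ii' x [xi xOm]; split.
  by apply: le_ball xi; rewrite ler_nat.
by apply: subset_trans xOm; apply: le_ball; rewrite lef_pV2 ?posrE// ler_nat.
Qed.

Lemma compact_sub_inner_set Om S : open Om -> compact S -> S `<=` Om ->
  exists i, S `<=` inner_set Om i.
Proof.
move=> oOm /compact_near_coveringP cS SOm.
suff [N _ /(_ N (leqnn N))] : \forall i \near \oo, S `<=` inner_set Om i by exists N.
apply: (cS nat \oo (fun i x => inner_set Om i x)) => x /SOm Omx.
have /nbhs_ballP[_/posnumP[e] eOm] := oOm _ Omx.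
have e2 : 0 < e%:num / 2 by [].
have large : \forall i \near \oo, i.+1%:R^-1 < (PosNum e2)%:num /\
    `|x| + e%:num / 2 < i.+1%:R.
  near=> i; split; first by near: i; exact: near_infty_natSinv_lt.
  apply: lt_le_trans (_ : i%:R <= _); last by rewrite ler_nat.
  by near: i; exact: nbhs_infty_gtr.
exists (ball x (e%:num / 2), [set i | i.+1%:R^-1 < (PosNum e2)%:num /\
    `|x| + e%:num / 2 < i.+1%:R]) => /=.
  by split; first exact: nbhsx_ballx.
move=> [y i] /= [xy [ie xi]]; split.
  rewrite -ball_normE /= sub0r normrN; apply: le_lt_trans xi.
  rewrite -ball_normE /= in xy.
  by rewrite -lerBlDl; apply: le_trans (ltW xy); rewrite distrC lerB_dist.
apply: subset_trans eOm => z yz; rewrite [e%:num]splitr.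
by apply: ball_triangle xy _; apply: le_ball yz; exact: ltW.
Unshelve. all: by end_near. Qed.

Lemma bounded_measure (B : R) : exists V : R,
  forall D : set 'rV[R]_d, measurable D -> D `<=` ball 0 B ->
  (mu D <= V%:E)%E.
Proof.
have [n nP] := @cell_of_bounded R d B 1 ltr01.
have mphi l := @measurable_grid_cell R d 1 l ltr01.
exists (\sum_(l <- @lattice_box d n) 1) => D mD DB.
apply: (@le_trans _ _ (mu [set x | cell_of 1 x \in lattice_box n])).
  apply: le_measure; rewrite ?inE//; last by move=> x /DB /nP.
  exact: (measurable_preimage_countable mphi [set` _]).
rewrite (measure_partition mphi (@lattice_box_uniq d n)) -sumEFin.
apply: lee_sum => l _.
by rewrite [leLHS](@lebesgue_grid_cell R d 1 l ltr01) expr1n.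
Qed.

End exhaustion.

Lemma filter_seq (I : eqType) (T : Type) (F : set_system T) (P : I -> T -> Prop) (s : seq I) :
  Filter F -> (forall i, \forall x \near F, P i x) ->
  \forall x \near F, {in s, forall i, P i x}.
Proof.
move=> FF FP; elim: s => [|i s IHs]; first exact: nearW.
apply: filterS2 (FP i) IHs => x Pi Ps j; rewrite inE => /orP[/eqP ->//|]; exact: Ps.
Qed.

Section strong_limit.
Context {R : realType} {d : nat}.
Local Notation mu := (@lebesgue_rV R d).
Local Notation unit_vec m := (delta_mx ord0 m : 'rV[int]_d).

Lemma strong_compactness (Om : set 'rV[R]_d) (h : nat -> R) (kappa C1 C2 : R)
    (v : nat -> 'rV[int]_d -> R) :
  (forall n, 0 < h n) -> h n @[n --> \oo] --> 0 -> 0 < kappa ->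
  (forall n s, uniq s -> h n ^+ d * \sum_(l <- s) v n l ^+ 2 <= C1) ->
  (forall n m t, uniq t ->
     {in t, forall p, deep Om kappa (h n) p /\ deep Om kappa (h n) (p + unit_vec m)} ->
     h n ^+ d * \sum_(p <- t) (v n (p + unit_vec m) - v n p) ^+ 2 <= C2 * h n ^+ 2) ->
  exists phi : nat -> nat, {homo phi : m n / (m < n)%N} /\
  exists2 u : 'rV[R]_d -> R, measurable_fun setT u &
  exists C, forall i, (sqint mu (inner_set Om i)
    (fun x => v (phi i) (cell_of (h (phi i)) x) - u x)%R <= (C / 4 ^+ i)%:E)%E.
Proof.
move=> h0 hcvg k0 vC1 vC2.
have [U [uU ooU]] := ultraFilterLemma eventually_filter.
have PU : ProperFilter U by exact: ultra_proper.
pose dl j : R := 2^-1 ^+ j.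
have dl0 j : 0 < dl j by rewrite exprn_gt0.
have dl2 j : dl j ^+ 2 = (4 ^+ j)^-1.
  rewrite -exprVn /dl -exprM mulnC exprM; congr (_ ^+ _).
  by rewrite expr2 -invfM -natrM.
pose c n j q := coarse_mean (dl j) (h n) (v n) q.
pose c' j q := lim (c n j q @[n --> U]).
have cU j q : c n j q @[n --> U] --> c' j q.
  apply: (@ultra_bounded_cvg _ _ _ _ (dl j ^- d * C1 + 1)) => // n.
  have := sqr_coarse_mean_le q (dl0 j) (h0 n) (vC1 n); rewrite -/(c n j q).
  move: (c n j q) (_ * C1) => x a xa.
  rewrite ler_norml; apply/andP.
  by have := sqr_ge0 (x - 1); have := sqr_ge0 (x + 1); rewrite !expr2 in xa *; split; lra.
pose Un n x := v n (cell_of (h n) x).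
pose A j x := c' j (cell_of (dl j) x).
have mU n : measurable_fun setT (Un n).
  by apply: measurable_fun_countable => l; exact: measurable_grid_cell.
have mA j : measurable_fun setT (A j).
  by apply: measurable_fun_countable => l; exact: measurable_grid_cell.
have mc n j : measurable_fun setT (fun x => c n j (cell_of (dl j) x)).
  by apply: measurable_fun_countable => l; exact: measurable_grid_cell.
pose K i := inner_set Om i.
have mK i : measurable (K i) by exact: measurable_inner_set.
(* For j >= i + 3, 4 * 2^-j <= 2^-(i+1) <= 1/(i+1). The margin to be paid is 2 dl + (2 + kappa) h,
   at most 3 dl once h is small. *)
pose J i := (i + 3)%N.
have Jdl i j : (J i <= j)%N -> 4 * dl j <= i.+1%:R^-1.
  move=> Jj; apply: (@le_trans _ _ (4 * dl (J i))).
    by rewrite ler_wpM2l// /dl ler_wiXn2l// ?invf_le1// ?ler1n.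
  have -> : 4 * dl (J i) = 2^-1 ^+ i.+1.
    by rewrite /dl /J exprD (exprS _ i); move: (2^-1 ^+ i) => e; field.
  have : i.+1%:R <= 2 ^+ i.+1 :> R by rewrite -natrX ler_nat ltnW// ltn_expl.
  by rewrite -lef_pV2 ?posrE ?exprn_gt0// -exprVn.
pose C3 := 2 * 5 ^+ d * d%:R ^+ 2 * C2.
pose C4 := 2 * (C3 + 1).
(* At scale dl j the function is close to its own averages uniformly in n, and those converge along
   U on the finitely many coarse cells that meet K i. *)
have near_A i j : (J i <= j)%N ->
    \forall n \near U, (sqint mu (K i) (Un n \- A j)%R <= (C4 / 4 ^+ j)%:E)%E.
  move=> Jj; have small : \forall n \near U, (2 + kappa) * h n <= dl j.
    have e0 : 0 < dl j / (2 + kappa) by rewrite divr_gt0// addr_gt0.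
    suff : \forall n \near \oo, (2 + kappa) * h n <= dl j by exact: ooU.
    near=> n; rewrite mulrC -ler_pdivlMr ?addr_gt0//; near: n.
    exact: (cvgr_le _ hcvg _ e0).
  have [V VP] := @bounded_measure R d i.+1%:R.
  have V0 : 0 <= V.
    by rewrite -lee_fin; apply: le_trans (VP set0 _ _) => //; rewrite measure0.
  (* A uniform error eta on K i costs eta^2 V <= 4^-j in squared norm; V + 1 guards against V =
     0. *)
  pose eta := Num.sqrt ((4 ^+ j * (V + 1))^-1).
  have eta2 : eta ^+ 2 = (4 ^+ j * (V + 1))^-1.
    by rewrite sqr_sqrtr// invr_ge0 mulr_ge0// ?exprn_ge0// addr_ge0.
  have eta0 : 0 < eta.
    by rewrite sqrtr_gt0 invr_gt0 mulr_gt0// ?exprn_gt0// ltr_wpDl.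
  have [N NP] := @cell_of_bounded R d i.+1%:R (dl j) (dl0 j).
  have : \forall n \near U, {in lattice_box N, forall q, `|c n j q - c' j q| <= eta}.
    apply: filter_seq => q; have := cU j q.
    move=> /cvgr_dist_le/(_ _ eta0); apply: filterS => n; by rewrite distrC.
  apply: filterS2 small => n small near_c.
  rewrite (_ : Un n \- A j = (fun x => Un n x - c n j (cell_of (dl j) x)) \-
      (fun x => A j x - c n j (cell_of (dl j) x))); last first.
    by apply/funext => x /=; rewrite opprB addrA subrK.
  rewrite (_ : C4 / 4 ^+ j = 2 * (C3 / 4 ^+ j + (4 ^+ j)^-1)); last first.
    by rewrite /C4; ring.
  apply: sqintB => //; try exact: measurable_funB.
    rewrite -dl2; apply: (sqint_oscillation (h0 n) _ k0 _ (mK i)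
      (@inner_set_ball R d Om i) (rho := i.+1%:R^-1) (Om := Om)).
    - by apply: le_trans _ small; rewrite mulrDl; have := mulr_gt0 k0 (h0 n); have := h0 n; lra.
    - by apply: le_trans _ (Jdl _ _ Jj); have := small; have := dl0 j; lra.
    - by move=> x [].
    - exact: vC2.
  apply: (@le_trans _ _ (sqint mu (K i) (cst eta))).
    apply: le_sqint => //; first exact: measurable_funB.
    move=> x [Bx _]; rewrite /= distrC (ger0_norm (ltW eta0)); apply: near_c.
    exact: NP.
  rewrite /sqint /= integral_cst//; apply: (@le_trans _ _ ((eta ^+ 2)%:E * V%:E)%E).
    by rewrite lee_wpmul2l ?lee_fin ?sqr_ge0//; apply: VP => //; exact: inner_set_ball.
  rewrite -EFinM lee_fin eta2 invfM -mulrA ler_piMr ?invr_ge0 ?exprn_ge0//.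
  by rewrite mulrC ler_pdivrMr ?ltr_wpDl// mul1r lerDl.
have C40 i j : (J i <= j)%N -> 0 <= C4.
  move=> /near_A /filter_ex[n]; move/(le_trans (sqint_ge0 _ _ _)).
  by rewrite lee_fin pmulr_lge0// invr_gt0 exprn_gt0.
have [u mfu uA] : exists2 u : 'rV[R]_d -> R, measurable_fun setT u &
    forall i j, (J i <= j)%N -> (sqint mu (K i) (u \- A j)%R <= (4 * C4 / 4 ^+ j)%:E)%E.
  apply: sqint_complete => // i j j' Jj jj'.
  (* Two scales are compared through a single Un n close to both averages, which exists because two
     members of U intersect. *)
  have [n [nj nj']] := filter_ex (filterI (near_A _ _ Jj) (near_A _ _ (leq_trans Jj jj'))).
  rewrite (_ : A j' \- A j = (Un n \- A j) \- (Un n \- A j')); last first.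
    by apply/funext => x /=; ring.
  apply: le_trans (sqintB (mK i) _ _ nj nj') _; try exact: measurable_funB.
  rewrite lee_fin.
  have : C4 / 4 ^+ j' <= C4 / 4 ^+ j.
    rewrite ler_wpM2l ?(C40 i j)// lef_pV2 ?posrE ?exprn_gt0//.
    by rewrite ler_weXn2l// ler1n.
  lra.
pose C := 10 * C4.
have near_u i : \forall n \near U, (sqint mu (K i) (Un n \- u)%R <= (C / 4 ^+ i)%:E)%E.
  apply: filterS (near_A _ _ (leqnn (J i))) => n Ui.
  rewrite (_ : Un n \- u = (Un n \- A (J i)) \- (u \- A (J i))); last first.
    by apply/funext => x /=; ring.
  apply: le_trans (sqintB (mK i) _ _ Ui (uA _ _ (leqnn _))) _; try exact: measurable_funB.
  rewrite lee_fin /C.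
  have : C4 / 4 ^+ J i <= C4 / 4 ^+ i.
    rewrite ler_wpM2l ?(C40 i _ (leqnn _))// lef_pV2 ?posrE ?exprn_gt0//.
    by rewrite ler_weXn2l ?leq_addr// ler1n.
  lra.
have /choice[f fP] i : exists f : nat -> nat, forall N, (N <= f N)%N /\
    (sqint mu (K i) (Un (f N) \- u)%R <= (C / 4 ^+ i)%:E)%E.
  have /choice[f fP] N : exists n, (N <= n)%N /\
      (sqint mu (K i) (Un n \- u)%R <= (C / 4 ^+ i)%:E)%E.
    have : U [set n | (N <= n)%N] by apply: ooU; exact: nbhs_infty_ge.
    by move=> /(filterI (near_u i)) /filter_ex[n [? ?]]; exists n.
  by exists f.
(* U contains all tails, so good indices for K i exist beyond any bound. Tying the accuracy to the
   set that grows with i makes one subsequence work for every compact set. *)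
pose phi := fix phi i := if i is i'.+1 then f i (phi i').+1 else f 0%N 0%N.
exists phi; split.
  apply: homo_ltn => [m n p|n]; first exact: ltn_trans.
  by case: (fP n.+1 (phi n).+1).
exists u => //; exists C => -[|i]; first by have [] := fP 0%N 0%N.
by have [] := fP i.+1 (phi i).+1.
Unshelve. all: by end_near. Qed.

End strong_limit.

(** * Weak gradient of the limit *)

Section ip_limits.
Context d (T : measurableType d) (R : realType) (mu : {measure set T -> \bar R}).
Local Notation sqi := (sqintegrable mu).

(** Bounded against vanishing: in [ip_le] the weight e / (C + 1) makes both terms at most e; C + 1
    because C may be 0. *)
Lemma ip_cvg0 (f g : nat -> T -> R) (C : R) :
  (\forall n \near \oo, [/\ sqi (f n), sqi (g n) & ip mu (f n) (f n) <= C]) ->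
  ip mu (g n) (g n) @[n --> \oo] --> 0 -> ip mu (f n) (g n) @[n --> \oo] --> 0.
Proof.
move=> fgC g0; apply/cvgr0Pnorm_le => e e0.
have C0 : 0 <= C.
  by have [n [sf _ fC]] := filter_ex fgC; apply: le_trans fC; exact: ip_ge0.
have t0 : 0 < e / (C + 1) by rewrite divr_gt0// ltr_wpDl.
have te0 : 0 < e * (e / (C + 1)) by rewrite mulr_gt0.
near=> n; have [sf sg fC] : [/\ sqi (f n), sqi (g n) & ip mu (f n) (f n) <= C].
  by near: n.
have gn : ip mu (g n) (g n) <= e * (e / (C + 1)).
  by near: n; exact: (cvgr_le _ g0).
have := ip_le t0 sf sg.
have : (e / (C + 1))^-1 * ip mu (g n) (g n) <= e.
  by rewrite mulrC ler_pdivrMr.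
have : e / (C + 1) * ip mu (f n) (f n) <= e.
  rewrite mulrAC ler_pdivrMr ?ltr_wpDl// ler_wpM2l ?ltW//.
  by apply: le_lt_trans fC _; rewrite ltrDl.
lra.
Unshelve. all: by end_near. Qed.

Lemma cvg0_of_sqr_bound (a : nat -> R) (V : R) : 0 <= V -> (forall n, 0 <= a n) ->
  (forall e, 0 < e -> \forall n \near \oo, a n <= e ^+ 2 * V) -> a n @[n --> \oo] --> 0.
Proof.
move=> V0 a0 aV; apply/cvgr0Pnorm_le => e e0.
have q0 : 0 < e / (V + 1) by rewrite divr_gt0// ltr_wpDl.
have := aV (Num.sqrt (e / (V + 1))); rewrite sqrtr_gt0 => /(_ q0).
apply: filterS => n; rewrite sqr_sqrtr ?(ltW q0)// ger0_norm// => /le_trans; apply.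
by rewrite mulrAC ler_pdivrMr ?ltr_wpDl// ler_wpM2l ?(ltW e0)// lerDl.
Qed.

Lemma integral_ip (f g : T -> R) : sqi f -> sqi g ->
  (\int[mu]_x (f x * g x)%:E = (ip mu f g)%:E)%E.
Proof.
move=> sf sg; rewrite /ip /Rintegral fineK//.
by apply: (integrable_fin_num measurableT); exact: sqintegrable_mul.
Qed.

Lemma sqintegrable_restrict (D : set T) (f : T -> R) : measurable D ->
  measurable_fun setT f -> (sqint mu D f < +oo)%E -> sqi (f \_ D).
Proof.
move=> mD mf fD; split; last by rewrite -sqint_restrict.
by apply/(measurable_restrictT f mD); exact: measurable_funS mf.
Qed.

End ip_limits.

Section cell_functions.
Context {R : realType} {d : nat}.
Implicit Types (x y : 'rV[R]_d) (l : 'rV[int]_d) (F G : 'rV[int]_d -> R).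
Local Notation mu := (@lebesgue_rV R d).

Lemma sqint_cells F (s : seq 'rV[int]_d) (h : R) : 0 < h -> uniq s ->
  (forall l, l \notin s -> F l = 0) ->
  sqint mu setT (F \o cell_of h) = (h ^+ d * \sum_(l <- s) F l ^+ 2)%:E.
Proof.
move=> h0 us Fs; have mphi l := @measurable_grid_cell R d h l h0.
have -> : sqint mu setT (F \o cell_of h) =
    sqint mu [set x | cell_of h x \in s] (F \o cell_of h).
  rewrite [RHS]sqint_restrict; apply: eq_sqint => x _; rewrite patchE.
  by case: ifPn => // /negP xs; apply: Fs; apply/negP => h'; apply: xs; rewrite inE.
have F0 l : (0 <= (F l ^+ 2)%:E)%E by rewrite lee_fin sqr_ge0.
rewrite /sqint/= (ge0_integral_partition mu mphi us F0) mulr_sumr -sumEFin.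
apply: eq_bigr => l _.
by rewrite [X in (_ * X)%E](@lebesgue_grid_cell R d h l h0) -EFinM mulrC.
Qed.

Lemma sqintegrable_cells F (s : seq 'rV[int]_d) (h : R) : 0 < h -> uniq s ->
  (forall l, l \notin s -> F l = 0) -> sqintegrable mu (F \o cell_of h).
Proof.
move=> h0 us Fs; split; last by rewrite (sqint_cells h0 us Fs) ltry.
by apply: measurable_fun_countable => l; exact: measurable_grid_cell.
Qed.

(** Polarisation of [sqint_cells], as the partition formula is available for nonnegative
    integrands. *)
Lemma ip_cells F G (s : seq 'rV[int]_d) (h : R) : 0 < h -> uniq s ->
  (forall l, l \notin s -> F l = 0) -> (forall l, l \notin s -> G l = 0) ->
  ip mu (F \o cell_of h) (G \o cell_of h) = h ^+ d * \sum_(l <- s) F l * G l.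
Proof.
move=> h0 us Fs Gs.
have sF := sqintegrable_cells h0 us Fs; have sG := sqintegrable_cells h0 us Gs.
have FGs l : l \notin s -> F l + G l = 0 by move=> ls; rewrite Fs// Gs// addr0.
have sFG := sqintegrable_cells h0 us FGs.
have normE H : sqintegrable mu (H \o cell_of h) -> (forall l, l \notin s -> H l = 0) ->
    ip mu (H \o cell_of h) (H \o cell_of h) = h ^+ d * \sum_(l <- s) H l ^+ 2.
  by move=> sH Hs; apply: EFin_inj; rewrite -sqintE// (sqint_cells h0 us Hs).
have := normE _ sFG FGs.
rewrite (_ : (fun l => F l + G l) \o cell_of h = (F \o cell_of h) \+ (G \o cell_of h))//.
rewrite ipDl ?ipDr//.
rewrite (normE F)// (normE G)// (ipC mu (G \o _)).
have -> : \sum_(l <- s) (F l + G l) ^+ 2 = \sum_(l <- s) F l ^+ 2 +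
    2 * (\sum_(l <- s) F l * G l) + \sum_(l <- s) G l ^+ 2.
  by rewrite mulr_sumr -!big_split/=; apply: eq_bigr => l _; ring.
rewrite !mulrDr; lra.
Qed.

Lemma sqint_bounded_support (B : R) : exists2 V : R, 0 <= V &
  forall (f : 'rV[R]_d -> R) (M : R), measurable_fun setT f -> 0 <= M ->
    (forall x, `|f x| <= M) -> (forall x, f x != 0 -> ball 0 B x) ->
    (sqint mu setT f <= (M ^+ 2 * V)%:E)%E.
Proof.
have [V VP] := @bounded_measure R d B; exists V.
  by rewrite -lee_fin; apply: le_trans (VP set0 _ _) => //; rewrite measure0.
move=> f M mf M0 fM fB; pose D : set 'rV[R]_d := ball 0 B.
have mD : measurable D.
  have [B0|B0] := ltP 0 B; first by apply: measurable_open; exact: ball_open.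
  suff -> : D = set0 by [].
  by apply/seteqP; split => // x [B0' _]; move: B0'; rewrite ltNge B0.
apply: (@le_trans _ _ (sqint mu D (cst M))).
  rewrite (_ : sqint mu setT f = sqint mu D f); last first.
    rewrite [RHS]sqint_restrict; apply: eq_sqint => x _; rewrite patchE.
    case: ifPn => // /negP xD; apply: contrapT => /eqP /fB xB; apply: xD.
    by rewrite inE.
  by apply: le_sqint => // x _; rewrite /= (ger0_norm M0).
rewrite /sqint /= integral_cst// [leRHS]EFinM lee_wpmul2l ?lee_fin ?sqr_ge0//.
exact: VP.
Qed.

End cell_functions.

Section compact_support.
Context {R : realType} {d : nat}.
Implicit Types (x y : 'rV[R]_d) (S : set 'rV[R]_d) (f : 'rV[R]_d -> R).

(** Heine-Cantor on the whole space: two points with nonzero value at one of them are compared from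
    that point, which is in S; otherwise both values vanish. *)
Lemma compact_support_unif f S : continuous f -> compact S ->
  (forall x, f x != 0 -> S x) ->
  forall e, 0 < e -> exists2 r, 0 < r &
    forall x y, (forall m, `|x ord0 m - y ord0 m| <= r) -> `|f x - f y| <= e.
Proof.
move=> cf /compact_near_coveringP cS fS e e0.
pose P n x := forall y, ball x n.+1%:R^-1 y -> `|f x - f y| <= e.
have [N _ /(_ N (leqnn N)) NP] : \forall n \near \oo, S `<=` P n.
  apply: cS => x0 Sx0; have e2 : 0 < e / 2 by rewrite divr_gt0.
  have := cf x0; move=> /cvgr_dist_lt/(_ _ e2) /nbhs_ballP[_/posnumP[r] rP].
  have r2 : 0 < r%:num / 2 by [].
  exists (ball x0 (r%:num / 2), [set n | n.+1%:R^-1 < (PosNum r2)%:num]) => /=.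
    by split; [exact: nbhsx_ballx|exact: (near_infty_natSinv_lt (PosNum r2))].
  move=> [x n] /= [x0x nr] y xy.
  have fx : `|f x0 - f x| < e / 2.
    by apply: rP; apply: le_ball x0x; rewrite ler_pdivrMr// ler_peMr// ler1n.
  have fy : `|f x0 - f y| < e / 2.
    by apply: rP; rewrite [r%:num]splitr; apply: ball_triangle x0x _; apply: le_ball xy; exact: ltW.
  rewrite [e]splitr -(subrKA (f x0)); apply: le_trans (ler_normD _ _) _.
  by rewrite lerD ?ltW// distrC.
have N0 : 0 < N.+1%:R^-1 :> R by [].
exists (N.+1%:R^-1 / 2); first by rewrite divr_gt0.
move=> x y xy; have xNy : ball x N.+1%:R^-1 y.
  apply/ballP => // m; apply: le_lt_trans (xy m) _.
  by rewrite ltr_pdivrMr// ltr_pMr// ltr1n.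
have [fx0|/fS Sx] := eqVneq (f x) 0; last exact: NP.
have [fy0|/fS Sy] := eqVneq (f y) 0; last first.
  by rewrite distrC; apply: NP => //; exact: ball_sym.
by rewrite fx0 fy0 subrr normr0 ltW.
Qed.

Lemma compact_support_bounded f S : continuous f -> compact S ->
  (forall x, f x != 0 -> S x) -> exists2 M, 0 <= M & forall x, `|f x| <= M.
Proof.
move=> cf cS fS.
have /compact_bounded[M [Mr MP]] : compact (f @` S).
  by apply: continuous_compact => //; exact: continuous_subspaceT.
exists (`|M| + 1); first by rewrite addr_ge0.
move=> x; have [->|/fS Sx] := eqVneq (f x) 0; first by rewrite normr0 addr_ge0.
apply: (MP (`|M| + 1)); last by exists x.
by apply: le_lt_trans (ler_norm _) _; rewrite ltrDl.
Qed.

Lemma partial_mean_value f (m : 'I_d) (a : 'rV[R]_d) (h : R) : 0 < h ->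
  (forall x, derivable f x (delta_mx ord0 m)) ->
  exists2 t, 0 <= t <= h & f (a + h *: delta_mx ord0 m) - f a =
    h * partial m f (a + t *: delta_mx ord0 m).
Proof.
move=> h0 df; pose e : 'rV[R]_d := delta_mx ord0 m; pose g (t : R) : R := f (a + t *: e).
have gE (t : R) : (fun s : R => s^-1 *: (g (s *: 1 + t) - g t)) =
    (fun s : R => s^-1 *: (f (s *: e + (a + t *: e)) - f (a + t *: e))).
  apply/funext => s; rewrite /g; congr (_ *: (f _ - _)).
  by rewrite [s *: 1]mulr1 scalerDl addrCA.
have dg (t : R) : is_derive t 1 g (partial m f (a + t *: e)).
  split; first by have := df (a + t *: e); rewrite /derivable -/e -gE.
  by rewrite /partial /derive -/e -gE.
have cg : {within `[0, h], continuous g}.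
  apply: derivable_within_continuous => t _.
  by have := dg t => -[].
have [t + tE] := @MVT R g _ 0 h h0 (fun t _ => dg t) cg.
rewrite in_itv/= => /andP[t0 th]; exists t; first by rewrite !ltW.
by move: tE; rewrite /g scale0r addr0 subr0 mulrC.
Qed.

End compact_support.

(** * Square integrability and weak derivatives of the limit *)

Section limit_function.
Context {R : realType} {d : nat}.
Implicit Types (x y : 'rV[R]_d) (l : 'rV[int]_d) (phi : 'rV[R]_d -> R).
Local Notation mu := (@lebesgue_rV R d).
Local Notation unit_vec m := (delta_mx ord0 m : 'rV[int]_d).

Lemma L2E (D : set 'rV[R]_d) (f : 'rV[R]_d -> R) :
  sqintegrable mu (f \_ D) -> L2 D f.
Proof.
move=> [mf fl]; rewrite /L2 inE; apply/andP; split; first by rewrite inE.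
rewrite inE /= /finite_norm unlock /=.
apply: poweR_lty; apply: le_lt_trans fl; rewrite le_eqVlt; apply/orP; left.
apply/eqP; apply: eq_integral => x _.
by rewrite /= powR_mulrn// -normrX ger0_norm// sqr_ge0.
Qed.

(** Off its closed support phi vanishes in a neighbourhood, so its partial derivative vanishes there
    too. *)
Lemma test_function_support (Om : set 'rV[R]_d) phi m : test_function Om phi ->
  exists S, [/\ compact S, S `<=` Om, (forall x, phi x != 0 -> S x) &
    forall x, partial m phi x != 0 -> S x].
Proof.
move=> [sphi cS SOm]; exists (closure [set x | phi x != 0]); split => // x.
  by move=> px; exact: subset_closure.
move=> dpx; apply: contrapT => xS.
have : \forall y \near x, phi y = 0.
  have : nbhs x (~` closure [set x | phi x != 0]).
    by apply: open_nbhs_nbhs; split => //; apply: closed_openC; exact: closed_closure.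
  apply: filterS => y yS; apply: contrapT => /eqP py; apply: yS.
  exact: subset_closure.
move=> phi0; case/eqP: dpx; rewrite /partial.
have -> : 'D_(delta_mx ord0 m) phi x = 'D_(delta_mx ord0 m) (cst 0) x.
  exact: near_eq_derive.
exact: derive_cst.
Qed.

Lemma compact_support_sqintegrable (f : 'rV[R]_d -> R) S :
  continuous f -> compact S -> (forall x, f x != 0 -> S x) -> sqintegrable mu f.
Proof.
move=> cf cS fS; have [M M0 fM] := compact_support_bounded cf cS fS.
have /compact_bounded[B [_ BP]] := cS.
have [V V0 VP] := @sqint_bounded_support R d (`|B| + 2).
have mf := continuous_measurable cf.
split => //; apply: le_lt_trans (VP _ _ mf M0 fM _) (ltry _).
move=> x /fS Sx; rewrite -ball_normE /= sub0r normrN.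
apply: le_lt_trans (BP (`|B| + 1) _ x Sx) _; last by rewrite ltrD2l ltr1n.
by apply: le_lt_trans (ler_norm _) _; rewrite ltrDl.
Qed.

Lemma test_function_sqintegrable (Om : set 'rV[R]_d) phi m :
  test_function Om phi ->
  sqintegrable mu phi /\ sqintegrable mu (partial m phi).
Proof.
move=> tphi; have [S [cS _ phiS dphiS]] := test_function_support m tphi.
have [sphi _ _] := tphi; have [[c0 _] [c1 _]] := (sphi [::], sphi [:: m]).
by split; apply: compact_support_sqintegrable cS _.
Qed.

Section limit.
Context (Om : set 'rV[R]_d) (h : nat -> R) (kappa C1 C2 C : R).
Context (v : nat -> 'rV[int]_d -> R) (u : 'rV[R]_d -> R).
Context (oOm : open Om) (h0 : forall n, 0 < h n) (hcvg : h n @[n --> \oo] --> 0).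
Context (k0 : 0 < kappa).
Context (vC1 : forall n s, uniq s -> h n ^+ d * \sum_(l <- s) v n l ^+ 2 <= C1).
Context (vC2 : forall n m t, uniq t ->
  {in t, forall p, deep Om kappa (h n) p /\ deep Om kappa (h n) (p + unit_vec m)} ->
  h n ^+ d * \sum_(p <- t) (v n (p + unit_vec m) - v n p) ^+ 2 <= C2 * h n ^+ 2).
Context (mfu : measurable_fun setT u).
Context (uC : forall i n, (i <= n)%N -> (sqint mu (inner_set Om i)
    (fun x => v n (cell_of (h n) x) - u x)%R <= (C / 4 ^+ n)%:E)%E).

Let Un n x := v n (cell_of (h n) x).

Let mUn n : measurable_fun setT (Un n).
Proof. by apply: measurable_fun_countable => l; exact: measurable_grid_cell. Qed.

Let C0 : 0 <= C.
Proof.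
have := le_trans (sqint_ge0 _ _ _) (uC (leqnn 0)).
by rewrite lee_fin expr0 divr1.
Qed.

Let sqintU i n : (sqint mu (inner_set Om i) (Un n) <= C1%:E)%E.
Proof.
apply: (sqint_cells_le (h0 n) _ (@inner_set_ball R d Om i)).
  exact: measurable_inner_set.
exact: vC1.
Qed.

(** Fatou along the exhaustion: on [inner_set Om i] the function Un i has squared norm at most C1
    and differs from u by at most C/4^i, so the truncations of u are bounded by 2 (C1 + C) whatever
    i. *)
Lemma limit_sqintegrable : sqintegrable mu (u \_ Om).
Proof.
have mOm := measurable_open oOm.
have mO : measurable_fun setT (u \_ Om).
  by apply/(measurable_restrictT u mOm); exact: measurable_funS mfu.
split => //; apply: (@le_lt_trans _ _ (2 * (C1 + C))%:E); last exact: ltry.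
rewrite (_ : u \_ Om = (u \_ Om) \- cst 0); last first.
  by apply/funext => x /=; rewrite subr0.
have mI i := @measurable_inner_set R d Om i.
apply: (@sqint_limit_le _ _ _ _ _ (fun i => u \_ (inner_set Om i))) => //.
- by move=> i; apply/(measurable_restrictT u (mI i)); exact: measurable_funS mfu.
- apply: aeW => x _; apply: cvg_near_cst.
  have [Omx|Omx] := pselect (Om x); last first.
    apply: nearW => i; rewrite !patchE !memNset// => /inner_set_sub.
    exact: Omx.
  have [|i xi] := @compact_sub_inner_set R d Om [set x] oOm (@compact_set1 _ x).
    by move=> _ ->.
  exists i => // n /= ni; rewrite !patchE !mem_set//.
  by apply: inner_set_mono ni _ _; exact: xi.
- apply: nearW => i; rewrite (_ : _ \- _ = u \_ (inner_set Om i)); last first.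
    by apply/funext => x /=; rewrite subr0.
  rewrite -sqint_restrict (_ : u = Un i \- (fun x => Un i x - u x)); last first.
    by apply/funext => x /=; rewrite opprB addrC subrK.
  have mB : measurable_fun setT (fun x => Un i x - u x)%R by exact: measurable_funB.
  apply: (le_trans (sqintB (mI i) (mUn i) mB (sqintU i i) (uC (leqnn i)))).
  rewrite lee_fin ler_wpM2l// lerD2l ler_pdivrMr ?exprn_gt0//.
  by rewrite ler_peMr// exprn_ege1// ler1n.
Qed.

(** The index 2i+1 has margin 1/(2(i+1)), half of the margin 1/(i+1); the other half is the radius
    of the neighbourhood. *)
Lemma inner_set_nbhs i x y : inner_set Om i x ->
  (forall m, `|x ord0 m - y ord0 m| < (2 * i.+1)%:R^-1) -> inner_set Om (2 * i).+1 y.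
Proof.
have e0 : 0 < (2 * i.+1)%:R^-1 :> R by rewrite invr_gt0 ltr0n.
have i2 : ((2 * i).+2 = 2 * i.+1)%N by lia.
move=> [Bx xOm] /(ballP x y e0) xy; rewrite /inner_set /= i2; split.
  apply: (@le_ball _ _ _ (i.+1%:R + (2 * i.+1)%:R^-1)); last exact: ball_triangle xy.
  rewrite natrM mulr_natl mulr2n lerD2l.
  apply: (@le_trans _ _ 1); last by rewrite ler1n.
  by rewrite -natrD invf_le1 ?ltr0n// ler1n.
apply: subset_trans xOm => z yz; apply: le_ball (ball_triangle xy yz).
by rewrite natrM le_eqVlt; apply/orP; left; apply/eqP; field.
Qed.

Section weak_derivative.
Context (m : 'I_d).
Local Notation e := (unit_vec m).

(* The bound on the position makes this finitely supported; since it grows with n,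
   it does not interfere with any given test function. *)
Let quotient_cell n l : R :=
  if `[< ball 0 n.+1%:R (grid_point (h n) l) /\
         deep Om kappa (h n) l /\ deep Om kappa (h n) (l + e) >]
  then (v n (l + e) - v n l) / h n else 0.

Let cell_of_grid_point n l : cell_of (h n) (grid_point (h n) l) = l.
Proof.
apply/grid_cellP => // j; rewrite grid_pointE in_itv/= lexx /= ltrDl.
exact: h0.
Qed.

Let quotient_support n : exists2 s : seq 'rV[int]_d, uniq s &
  (forall l, ball 0 n.+1%:R (grid_point (h n) l) -> l \in s).
Proof.
have [N NP] := @cell_of_bounded R d n.+1%:R (h n) (h0 n).
exists (lattice_box N); first exact: lattice_box_uniq.
by move=> l /NP; rewrite cell_of_grid_point.
Qed.

Let g n := quotient_cell n \o cell_of (h n).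

Let sg n : sqintegrable mu (g n).
Proof.
have [s us sP] := quotient_support n.
apply: (sqintegrable_cells (h0 n) us) => l ls; rewrite /quotient_cell.
by case: asboolP => // -[/sP]; rewrite (negbTE ls).
Qed.

Let gC2 n : ip mu (g n) (g n) <= C2.
Proof.
have [s us sP] := quotient_support n.
have qs l : l \notin s -> quotient_cell n l = 0.
  by move=> ls; rewrite /quotient_cell; case: asboolP => // -[/sP]; rewrite (negbTE ls).
rewrite -lee_fin -sqintE// (sqint_cells (h0 n) us qs) lee_fin.
pose t := [seq l <- s | `[< deep Om kappa (h n) l /\ deep Om kappa (h n) (l + e) >]].
have ut : uniq t by exact: filter_uniq.
have tP : {in t, forall p, deep Om kappa (h n) p /\ deep Om kappa (h n) (p + e)}.
  by move=> p; rewrite mem_filter => /andP[/asboolP].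
have h2 : 0 < h n ^+ 2 by rewrite exprn_gt0.
rewrite -(ler_pM2r h2) -mulrA mulr_suml; apply: le_trans (vC2 ut tP).
rewrite ler_wpM2l ?exprn_ge0 ?(ltW (h0 n))// /t [leRHS]big_filter [leRHS]big_mkcond.
apply: ler_sum => l _; rewrite /quotient_cell.
case: asboolP => [[_ dl]|_]; last by rewrite expr0n mul0r; case: ifP; rewrite ?sqr_ge0.
by rewrite asboolT// -exprMn divfK ?gt_eqF.
Qed.

(** An exact summation by parts turns the forward quotients of v into the backward quotients Psi of
    the samples Phi. Three errors remain: phi against Phi, Psi against the derivative, and Un
    against u, each vanishing in L^2 while paired with something bounded. *)
Lemma quotient_converges phi : test_function Om phi ->
  ip mu (g n) phi @[n --> \oo] --> - ip mu (u \_ Om) (partial m phi).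
Proof.
move=> tphi; have [S [cS SOm phiS dphiS]] := test_function_support m tphi.
have [sphi _ _] := tphi.
have cphi : continuous phi by have [] := sphi [::].
have cdphi : continuous (partial m phi) by have [] := sphi [:: m].
have dphi x : derivable phi x (delta_mx ord0 m) by have [_] := sphi [::]; apply.
have [i Si] := compact_sub_inner_set oOm cS SOm.
(* K contains the r-neighbourhood of S, so once h is small it holds all cells on which the sampled
   or shifted test function is nonzero. *)
pose K := inner_set Om (2 * i).+1.
pose r : R := (2 * i.+1)%:R^-1.
have r0 : 0 < r by rewrite invr_gt0 ltr0n.
have SK x y : S x -> (forall j, `|x ord0 j - y ord0 j| < r) -> K y.
  by move=> /Si; exact: inner_set_nbhs.
have mK : measurable K by exact: measurable_inner_set.
have [V V0 VP] := @sqint_bounded_support R d (2 * i).+2%:R.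
pose Phi n l := phi (grid_point (h n) l).
pose Psi n l := (Phi n l - Phi n (l - e)) / h n.
have grid_shift n l j : grid_point (h n) (l - e) ord0 j =
    grid_point (h n) l ord0 j - h n * (j == m)%:R.
  by rewrite !grid_pointE !mxE eqxx /= intrB mulrBr; case: (j == m).
have add_deltaE (a : 'rV[R]_d) t j :
    (a + t *: delta_mx ord0 m) ord0 j = a ord0 j + t * (j == m)%:R.
  by rewrite !mxE eqxx.
have mcell n (F : 'rV[int]_d -> R) : measurable_fun setT (F \o cell_of (h n)).
  by apply: measurable_fun_countable => l; exact: measurable_grid_cell.
have mphi := continuous_measurable cphi.
have mdphi := continuous_measurable cdphi.
have small c : 0 < c -> \forall n \near \oo, h n <= c.
  by move=> c0; exact: (cvgr_le _ hcvg _ c0).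
have near_S x y : S x -> (forall j, `|x ord0 j - y ord0 j| < r) ->
    ball 0 (2 * i).+2%:R y.
  by move=> Sx xy; have [] := SK _ _ Sx xy.
have bounded_sqi (f : 'rV[R]_d -> R) : measurable_fun setT f ->
    (exists2 M, 0 <= M & forall x, `|f x| <= M) ->
    (forall x, f x != 0 -> ball 0 (2 * i).+2%:R x) -> sqintegrable mu f.
  move=> mf [M M0 fM] fB; split => //.
  by apply: le_lt_trans (VP _ _ mf M0 fM fB) (ltry _).
have S_ball x : S x -> ball 0 (2 * i).+2%:R x.
  by move=> Sx; apply: near_S Sx _ => j; rewrite subrr normr0.
have [s_phi s_dphi] := test_function_sqintegrable m tphi.
(* Uniform smallness together with support in a fixed ball gives smallness in L^2. *)
have vanishing (F : nat -> 'rV[R]_d -> R) : (forall n, measurable_fun setT (F n)) ->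
    (forall eta, 0 < eta -> \forall n \near \oo, (forall x, `|F n x| <= eta) /\
       (forall x, F n x != 0 -> ball 0 (2 * i).+2%:R x)) ->
    (\forall n \near \oo, sqintegrable mu (F n)) /\
    ip mu (F n) (F n) @[n --> \oo] --> 0.
  move=> mF Feta; have sF : \forall n \near \oo, sqintegrable mu (F n).
    apply: filterS (Feta 1 ltr01) => n [F1 FB].
    by apply: bounded_sqi => //; exists 1.
  split => //; apply: cvg0_of_sqr_bound V0 _ _ => [n|eta eta0].
    by apply: Rintegral_ge0 => x _; rewrite -expr2 sqr_ge0.
  apply: filterS2 sF (Feta _ eta0) => n sFn [Fe FB].
  by rewrite -lee_fin -sqintE//; apply: VP => //; exact: ltW.
have near_grid n x j : h n < r -> `|grid_point (h n) (cell_of (h n) x) ord0 j - x ord0 j| < r.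
  by apply: le_lt_trans; exact: grid_point_cell.
(* Covers the shifted grid point, at t = 0, as well as the intermediate point of the mean value
   theorem. *)
have near_shift n x j t : 0 <= t <= h n ->
    `|grid_point (h n) (cell_of (h n) x - e) ord0 j + t * (j == m)%:R - x ord0 j| <= 2 * h n.
  move=> /andP[t0 th]; rewrite grid_shift; have := @grid_point_cell R d (h n) x j (h0 n).
  move: (grid_point (h n) (cell_of (h n) x) ord0 j) (x ord0 j) => a b.
  have : (j == m)%:R = 0 :> R \/ (j == m)%:R = 1 :> R by case: (j == m); [right|left].
  by move=> [] ->; rewrite !ler_norml => /andP[? ?]; apply/andP; split; lra.
have diff_phi eta : 0 < eta -> \forall n \near \oo,
    (forall x, `|phi x - Phi n (cell_of (h n) x)| <= eta) /\
    (forall x, phi x - Phi n (cell_of (h n) x) != 0 -> ball 0 (2 * i).+2%:R x).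
  move=> eta0; have [r1 r10 r1P] := compact_support_unif cphi cS phiS eta0.
  have r20 : 0 < r / 2 by rewrite divr_gt0.
  apply: filterS2 (small _ r10) (small _ r20) => n hr1 hr2.
  have hr : h n < r by apply: le_lt_trans hr2 _; lra.
  split => x.
    rewrite distrC; apply: r1P => j; apply: le_trans hr1; exact: grid_point_cell.
  have [->|/phiS/S_ball//] := eqVneq (phi x) 0.
  rewrite sub0r oppr_eq0 => /phiS Sx; apply: near_S Sx _ => j; exact: near_grid.
have diff_dphi eta : 0 < eta -> \forall n \near \oo,
    (forall x, `|Psi n (cell_of (h n) x) - partial m phi x| <= eta) /\
    (forall x, Psi n (cell_of (h n) x) - partial m phi x != 0 -> ball 0 (2 * i).+2%:R x).
  move=> eta0; have [r1 r10 r1P] := compact_support_unif cdphi cS dphiS eta0.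
  have r20 : 0 < r / 4 by rewrite divr_gt0.
  have r12 : 0 < r1 / 2 by rewrite divr_gt0.
  apply: filterS2 (small _ r12) (small _ r20) => n hr1 hr2.
  have hr : h n < r by apply: le_lt_trans hr2 _; lra.
  have h2r : 2 * h n < r by lra.
  split => x.
    have [t th] := partial_mean_value (grid_point (h n) (cell_of (h n) x - e)) (h0 n) dphi.
    set a := grid_point _ _.
    have -> : a + h n *: delta_mx ord0 m = grid_point (h n) (cell_of (h n) x).
      by apply/rowP => j; rewrite add_deltaE /a grid_shift subrK.
    rewrite -/(Phi n _) -/(Phi n _) => Phi_diff.
    rewrite {1}/Psi -/a -/(Phi n _) Phi_diff mulrAC mulfV ?gt_eqF// mul1r.
    apply: r1P => j; apply: (@le_trans _ _ (2 * h n)); last by lra.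
    rewrite add_deltaE; exact: near_shift.
  have [dx0|/dphiS/S_ball//] := eqVneq (partial m phi x) 0.
  rewrite dx0 subr0 /Psi mulf_eq0 negb_or => /andP[Psi0 _].
  have [Phi0|/phiS Sx] := eqVneq (Phi n (cell_of (h n) x)) 0; last first.
    by apply: near_S Sx _ => j; exact: near_grid.
  move: Psi0; rewrite Phi0 sub0r oppr_eq0 => /phiS Sx; apply: near_S Sx _ => j.
  apply: le_lt_trans h2r; have := near_shift n x j 0.
  by rewrite mul0r addr0 lexx ltW//; apply.
have [s_diff_phi lim_phi] := vanishing _ (fun n => measurable_funB mphi (mcell n (Phi n))) diff_phi.
have [s_diff_dphi lim_dphi] :=
  vanishing _ (fun n => measurable_funB (mcell n (Psi n)) mdphi) diff_dphi.
have sUK n : sqintegrable mu (Un n \_ K).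
  by apply: sqintegrable_restrict => //; apply: le_lt_trans (sqintU _ n) (ltry _).
have ipUK n : ip mu (Un n \_ K) (Un n \_ K) <= C1.
  by rewrite -lee_fin -sqintE// -sqint_restrict; exact: sqintU.
have suO := limit_sqintegrable.
have suK : sqintegrable mu (u \_ K).
  have mOm := measurable_open oOm.
  rewrite (_ : u \_ K = (u \_ Om) \_ K).
    apply: sqintegrable_restrict => //; first by case: suO.
    have [mO lO] := suO.
    exact: (le_lt_trans (sub_sqint mu mK measurableT mO (@subsetT _ K)) lO).
  apply/funext => x; rewrite !patchE; case: ifPn => // /set_mem /inner_set_sub Omx.
  by rewrite mem_set.
have lim_U : ip mu (Un n \_ K \- u \_ K) (Un n \_ K \- u \_ K) @[n --> \oo] --> 0.
  apply/cvgr0Pnorm_le => eta eta0.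
  have : \forall n \near \oo, C * 2^-1 ^+ n <= eta.
    have : C * 2^-1 ^+ n @[n --> \oo] --> C * 0.
      by apply: cvgM; [exact: cvg_cst|apply: cvg_expr; rewrite ger0_norm ?invf_lt1 ?ltr1n].
    by rewrite mulr0 => /cvgr_le; apply.
  apply: filterS2 (nbhs_infty_ge (2 * i).+1) => n /= ni Cn.
  have sB := sqintegrableB (sUK n) suK.
  rewrite ger0_norm ?ip_ge0// -lee_fin -sqintE//.
  rewrite (_ : _ \- _ = (fun x => Un n x - u x) \_ K); last first.
    by apply/funext => x; rewrite /= !patchE; case: ifP => // _; rewrite subr0.
  rewrite -sqint_restrict; apply: le_trans (uC ni) _; rewrite lee_fin.
  apply: le_trans Cn; rewrite ler_wpM2l// exprVn lef_pV2 ?posrE ?exprn_gt0//.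
  by rewrite lerXn2r ?nnegrE// ler_nat.
have ipK : ip mu (u \_ K) (partial m phi) = ip mu (u \_ Om) (partial m phi).
  apply: eq_Rintegral => x _; have [->|/dphiS Sx] := eqVneq (partial m phi x) 0.
    by rewrite !mulr0.
  have Kx : K x by apply: SK Sx _ => j; rewrite subrr normr0.
  by rewrite !patchE !mem_set//; exact: inner_set_sub Kx.
(* Three thresholds: n >= 2i+1 puts the support inside the growing cutoff of [quotient_cell]; (kappa
   + 2) h <= 1/(i+1) makes the cells that carry Phi and their neighbours deep; h <= r/4 keeps the
   shifted supports in K. *)
have by_parts : \forall n \near \oo,
    ip mu (g n) (Phi n \o cell_of (h n)) = - ip mu (Un n \_ K) (Psi n \o cell_of (h n)).
  have k20 : 0 < i.+1%:R^-1 / (kappa + 2) by rewrite divr_gt0 ?addr_gt0// invr_gt0.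
  have r20 : 0 < r / 4 by rewrite divr_gt0.
  apply: filterS3 (nbhs_infty_ge (2 * i).+1) (small _ k20) (small _ r20) => n /= ni hk hr4.
  have hr : h n < r by apply: le_lt_trans hr4 _; lra.
  have h2r : 2 * h n < r by lra.
  have {}hk : (kappa + 2) * h n <= i.+1%:R^-1.
    by move: hk; rewrite ler_pdivlMr ?addr_gt0// mulrC.
  have [s us sP] := quotient_support n.
  have ball_s l : ball 0 (2 * i).+2%:R (grid_point (h n) l) -> l \in s.
    by move=> lB; apply: sP; apply: le_ball lB; rewrite ler_nat.
  have Phi_s l : l \notin s -> Phi n l = 0.
    move=> ls; apply: contrapT => /eqP/phiS/S_ball/ball_s.
    by rewrite (negbTE ls).
  have Phi_e_s l : l \notin s -> Phi n (l - e) = 0.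
    move=> ls; apply: contrapT => /eqP/phiS Sx; move/negP: ls; apply.
    apply: ball_s; apply: near_S Sx _ => j; rewrite grid_shift addrAC subrr sub0r normrN.
    apply: le_lt_trans hr; rewrite normrM (gtr0_norm (h0 n)) ler_piMr ?(ltW (h0 n))//.
    by rewrite normr_nat; case: (j == m).
  have Psi_s l : l \notin s -> Psi n l = 0.
    by move=> ls; rewrite /Psi Phi_s// Phi_e_s// subrr mul0r.
  have q_s l : l \notin s -> quotient_cell n l = 0.
    by move=> ls; rewrite /quotient_cell; case: asboolP => // -[/sP]; rewrite (negbTE ls).
  (* Wherever Phi is nonzero the test in [quotient_cell] succeeds, so against Phi the quotient is
     the plain one. *)
  have qE l : quotient_cell n l * Phi n l = (h n)^-1 * (v n (l + e) * Phi n l - v n l * Phi n l).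
    have [->|/phiS Sx] := eqVneq (Phi n l) 0; first by rewrite !mulr0 subrr mulr0.
    rewrite /quotient_cell asboolT; first by rewrite -mulrBl mulrCA mulrA mulrC.
    have [_ xOm] := Si _ Sx; have h_n0 := h0 n.
    have kh : 0 < kappa * h n by rewrite mulr_gt0.
    split; first by apply: le_ball (S_ball _ Sx); rewrite ler_nat.
    split; apply: subset_trans xOm => y.
      by apply: le_ball; apply: le_trans hk; rewrite mulrDl lerDl mulr_ge0// ltW.
    move=> ey; apply: (@le_ball _ _ _ (2 * h n + kappa * h n)).
      by apply: le_trans hk; rewrite -mulrDl addrC.
    apply: ball_triangle ey; apply/ballP => [|j]; first by rewrite mulr_gt0//.
    have := grid_shift n (l + e) j; rewrite addrK => ->; rewrite addrAC subrr sub0r normrN.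
    apply: (@le_lt_trans _ _ (h n)); last by rewrite ltr_pMl// ltr1n.
    rewrite normrM (gtr0_norm h_n0) ler_piMr ?(ltW h_n0)// normr_nat.
    by case: (j == m).
  rewrite (ip_cells (h0 n) us q_s Phi_s).
  (* [ip_cells] wants finite support on both sides. Where Psi is nonzero, W and the restriction of
     Un to K agree. *)
  pose W l : R := if l \in s then v n l else 0.
  have W_s l : l \notin s -> W l = 0 by rewrite /W => /negbTE ->.
  have -> : ip mu (Un n \_ K) (Psi n \o cell_of (h n)) =
      ip mu (W \o cell_of (h n)) (Psi n \o cell_of (h n)).
    apply: eq_Rintegral => x _ /=.
    have [->|Psi0] := eqVneq (Psi n (cell_of (h n) x)) 0; first by rewrite !mulr0.
    have ls : cell_of (h n) x \in s by apply/negPn/negP => /Psi_s/eqP; rewrite (negbTE Psi0).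
    suff Kx : K x by rewrite /W ls patchE mem_set.
    move: Psi0; rewrite /Psi mulf_eq0 negb_or => /andP[Psi0 _].
    have [Phi0|/phiS Sx] := eqVneq (Phi n (cell_of (h n) x)) 0; last first.
      by apply: SK Sx _ => j; exact: near_grid.
    move: Psi0; rewrite Phi0 sub0r oppr_eq0 => /phiS Sx; apply: SK Sx _ => j.
    apply: le_lt_trans h2r; have := near_shift n x j 0.
    by rewrite mul0r addr0 lexx ltW//; apply.
  rewrite (ip_cells (h0 n) us W_s Psi_s) -mulrN; congr (_ * _).
  (* The translation by e is a bijection of the whole lattice but not of s, so the sums are first
     extended by zero terms. *)
  have shift_sum : \sum_(l <- s) v n (l + e) * Phi n l = \sum_(l <- s) v n l * Phi n (l - e).
    have fsE (F : 'rV[int]_d -> R) : (forall l, l \notin s -> F l = 0) ->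
        \sum_(l \in [set: 'rV[int]_d]) F l = \sum_(l <- s) F l.
      move=> Fs; rewrite (@fsbigE _ _ _ _ _ s)//; last by move=> l _; exact: Fs.
      by apply: eq_bigl => l; rewrite in_setT.
    rewrite -!fsE; last 2 first.
    - by move=> l ls; rewrite Phi_e_s// mulr0.
    - by move=> l ls; rewrite Phi_s// mulr0.
    rewrite (@reindex_fsbigT _ _ _ _ _ (fun l => l - e)).
      by apply: eq_fsbigr => l _; rewrite subrK.
    by exists (fun l => l + e) => l; rewrite ?subrK ?addrK.
  transitivity ((h n)^-1 * (\sum_(l <- s) v n (l + e) * Phi n l - \sum_(l <- s) v n l * Phi n l)).
    by rewrite -sumrB mulr_sumr; apply: eq_bigr => l _; exact: qE.
  rewrite shift_sum -sumrB mulr_sumr -sumrN; rewrite big_seq [RHS]big_seq.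
  apply: eq_bigr => l ls; rewrite /W ls /Psi; ring.
have lim1 : ip mu (g n) (phi \- (Phi n \o cell_of (h n))) @[n --> \oo] --> 0.
  apply: (@ip_cvg0 _ _ _ mu g _ C2) => //.
  by apply: filterS s_diff_phi => n sn; split; [exact: sg|exact: sn|exact: gC2].
have lim2 : ip mu (Un n \_ K) (Psi n \o cell_of (h n) \- partial m phi) @[n --> \oo] --> 0.
  apply: (@ip_cvg0 _ _ _ mu (fun n => Un n \_ K) _ C1) => //.
  by apply: filterS s_diff_dphi => n sn; split; [exact: sUK|exact: sn|exact: ipUK].
have lim3 : ip mu (partial m phi) (Un n \_ K \- u \_ K) @[n --> \oo] --> 0.
  apply: (@ip_cvg0 _ _ _ mu (fun=> partial m phi) _ (ip mu (partial m phi) (partial m phi))) => //.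
  by apply: nearW => n; split => //; exact: sqintegrableB.
(* By bilinearity and [by_parts] everything but [ip mu (g n) phi] cancels in this expression, while
   its limit retains only the last inner product. *)
pose rhs n := ip mu (g n) (phi \- (Phi n \o cell_of (h n))) -
    (ip mu (Un n \_ K) (Psi n \o cell_of (h n) \- partial m phi) +
     (ip mu (partial m phi) (Un n \_ K \- u \_ K) + ip mu (u \_ K) (partial m phi))).
have split_ip : {near \oo, rhs =1 (fun n => ip mu (g n) phi)}.
  apply: filterS3 by_parts s_diff_phi s_diff_dphi => n bp s1 s2.
  have sPhi : sqintegrable mu (Phi n \o cell_of (h n)).
    have := sqintegrableB s_phi s1; rewrite (_ : _ \- _ = Phi n \o cell_of (h n))//.
    by apply/funext => x /=; ring.
  have sPsi : sqintegrable mu (Psi n \o cell_of (h n)).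
    have := sqintegrableD s2 s_dphi; rewrite (_ : _ \+ _ = Psi n \o cell_of (h n))//.
    by apply/funext => x /=; rewrite subrK.
  rewrite /rhs !ipBr//.
  rewrite bp (ipC mu (partial m phi)) (ipC mu (partial m phi)); ring.
have lim : rhs n @[n --> \oo] --> 0 - (0 + (0 + ip mu (u \_ K) (partial m phi))).
  by apply: cvgB lim1 (cvgD lim2 (cvgD lim3 _)); exact: cvg_cst.
rewrite !add0r ipK in lim; apply: cvg_trans lim.
exact: (@near_eq_cvg _ _ _ _ rhs (fun n => ip mu (g n) phi) split_ip).
Qed.

(** Any weak limit point of the quotients will do: their pairings with a test function already
    converge along the full sequence, so the ultrafilter limit has to agree. *)
Lemma limit_weak_partial : exists2 w, sqintegrable mu w &
  forall phi, test_function Om phi ->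
    ip mu (u \_ Om) (partial m phi) = - ip mu w phi.
Proof.
have [U [uU ooU]] := ultraFilterLemma eventually_filter.
have PU : ProperFilter U by exact: ultra_proper.
have [w sw wP] := ultra_weak_limit uU sg gC2.
exists w => // phi tphi; apply: oppr_inj; rewrite opprK.
apply: (@cvg_unique _ _ (ip mu (g n) phi @[n --> U])) => //; last first.
  by apply: wP; have [] := test_function_sqintegrable m tphi.
apply: cvg_trans (quotient_converges tphi).
by apply: cvg_app; exact: ooU.
Qed.

End weak_derivative.
End limit.
End limit_function.

(** * Cell means *)

Section reduction.
Context {R : realType} {d k : nat}.
Implicit Types (X : set (site d k)) (T : nat) (l : 'rV[int]_d) (Om : set 'rV[R]_d).
Local Notation unit_vec m := (delta_mx ord0 m : 'rV[int]_d).

Lemma esum_ge_seq (I : choiceType) (S : set I) (a : I -> \bar R) (s : seq I) :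
  uniq s -> [set` s] `<=` S -> (\sum_(i <- s) a i <= \esum_(i in S) a i)%E.
Proof.
move=> us sS; apply: esum_ge; exists [set` s]; last by rewrite fsbig_seq.
by split => //; exact: finite_seq.
Qed.

(** Cauchy-Schwarz against the constant 1, from the nonnegative double sum of (f i - f j)^2. *)
Lemma sqr_sum_le (I : Type) (s : seq I) (f : I -> R) :
  (\sum_(i <- s) f i) ^+ 2 <= (size s)%:R * \sum_(i <- s) f i ^+ 2.
Proof.
have : 0 <= \sum_(i <- s) \sum_(j <- s) (f i - f j) ^+ 2.
  by apply: sumr_ge0 => i _; apply: sumr_ge0 => j _; exact: sqr_ge0.
have -> : \sum_(i <- s) \sum_(j <- s) (f i - f j) ^+ 2 =
    2 * ((size s)%:R * \sum_(i <- s) f i ^+ 2) - 2 * (\sum_(i <- s) f i) ^+ 2.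
  transitivity (\sum_(i <- s) ((size s)%:R * f i ^+ 2 - 2 * (f i * \sum_(j <- s) f j)
      + \sum_(j <- s) f j ^+ 2)).
    apply: eq_bigr => i _; rewrite -sum1_size natr_sum !(mulr_suml, mulr_sumr) -sumrB -big_split/=.
    by apply: eq_bigr => j _; ring.
  rewrite big_split/= sumrB -!mulr_sumr -mulr_suml big_const_seq count_predT.
  by rewrite iter_addr_0 -mulr_natl; ring.
lra.
Qed.

(** A crude finite superset of the sites of a cell; its size does not depend on l, which gives a
    uniform count. *)
Definition site_box T l : seq (site d k) :=
  [seq (T%:Z *: l + a, b) | a <- lattice_box T, b <- lattice_box T].

Lemma sites_sub_site_box X T l : sites X T (@cube R d T l) `<=` [set` site_box T l].
Proof.
move=> [i1 i2] [[/= c1 c2] _]; apply/allpairsP; exists (i1 - T%:Z *: l, i2) => /=.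
have small (z : int) : (z%:~R : R) \in `[0, T%:R[ -> (`|z| <= T)%N.
  rewrite in_itv/= => /andP[z0 zT].
  have : 0 <= z by rewrite -(ler_int R).
  have : z < T%:Z by rewrite -(ltr_int R).
  lia.
split; last by rewrite addrC subrK.
- apply/mem_lattice_box => m; apply: small; have := c1 m.
  by rewrite !mxE intrB intrM.
- apply/mem_lattice_box => m; apply: small; have := c2 m.
  by rewrite !mxE mulr0 subr0.
Qed.

Lemma site_box_uniq T l : uniq (site_box T l).
Proof.
apply: allpairs_uniq; [exact: lattice_box_uniq|exact: lattice_box_uniq|].
by move=> [a b] [a' b'] _ _ /= [/addrI -> ->].
Qed.

Lemma sqr_cell_mean_le X T (v : site d k -> R) l :
  exists s : seq (site d k), [/\ uniq s, [set` s] = sites X T (@cube R d T l) &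
    cell_mean (R := R) X T v l ^+ 2 <=
      (T.*2.+1 ^ d * T.*2.+1 ^ k)%:R * \sum_(i <- s) v i ^+ 2].
Proof.
pose s := [seq i <- site_box T l | `[< sites X T (@cube R d T l) i >]].
have us : uniq s by rewrite filter_uniq// site_box_uniq.
have sE : [set` s] = sites X T (@cube R d T l).
  apply/seteqP; split => i /=; first by rewrite mem_filter => /andP[/asboolP].
  move=> iX; rewrite mem_filter asboolT//=; exact: (sites_sub_site_box iX).
exists s; split => //; rewrite /cell_mean -sE -fsbig_seq// exprMn.
(* The normalising count enters only through 1/N <= 1; for N = 0 the inverse is 0 by convention. *)
set N := (X in (X%:R^-1) ^+ 2); have N1 : ((N%:R : R)^-1) ^+ 2 <= 1.
  case: N => [|N]; first by rewrite invr0 expr0n.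
  by rewrite expr_le1// ?invr_ge0// invf_le1// ler1n.
apply: (@le_trans _ _ ((\sum_(i <- s) v i) ^+ 2)).
  by rewrite ler_piMl// sqr_ge0.
apply: le_trans (sqr_sum_le _ _) _; rewrite ler_wpM2r//.
  by apply: sumr_ge0 => i _; exact: sqr_ge0.
rewrite ler_nat; apply: leq_trans (_ : size (site_box T l) <= _)%N.
  by rewrite size_filter count_size.
by rewrite size_allpairs !size_lattice_box.
Qed.

Lemma enorm_delta (m : 'I_d) : enorm (rvec (unit_vec m) : 'rV[R]_d) = 1.
Proof.
rewrite /enorm (bigD1 m)//= big1 => [|j jm].
  by rewrite addr0 !mxE !eqxx /= expr1n sqrtr1.
by rewrite !mxE (negbTE jm) /= expr0n.
Qed.

Lemma le_enorm n (x : 'rV[R]_n) m : `|x ord0 m| <= enorm x.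
Proof.
rewrite /enorm -sqrtr_sqr ler_wsqrtr// (bigD1 m)//= lerDl.
by apply: sumr_ge0 => j _; exact: sqr_ge0.
Qed.

Lemma grid_point_scale T (e : R) l :
  e *: (T%:R *: rvec l) = grid_point (e * T%:R) l :> 'rV[R]_d.
Proof. by apply/rowP => m; rewrite !mxE mulrA. Qed.

Lemma eps_cubeE T (e : R) l : 0 < e -> (0 < T)%N ->
  eps_cube T e l = grid_cell (e * T%:R) l.
Proof.
move=> e0 T0; have h0 : 0 < e * T%:R by rewrite mulr_gt0// ltr0n.
apply/seteqP; split => [_ [y yl <-]|x /(grid_cellP _ _ h0) xl].
  apply/grid_cellP => // m; have := yl m; rewrite !mxE !in_itv/= => /andP[y1 y2].
  rewrite -mulrA -mulrDr ler_pM2l// ltr_pM2l//.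
  by apply/andP; split; lra.
exists (e^-1 *: x); last by rewrite scalerA mulfV ?scale1r// gt_eqF.
move=> m; have := xl m; rewrite !mxE !in_itv/= -mulrA -mulrDr.
by rewrite -ler_pdivlMl// -ltr_pdivrMl// => /andP[? ?]; apply/andP; split; lra.
Qed.

(* 2 sqrt d is the width required by deep_cells; the rest leaves room for the cell
   itself. *)
Definition deep_width : R := 2 * Num.sqrt d%:R + 4.

Lemma deep_width_gt0 : 0 < deep_width.
Proof. by rewrite /deep_width ltr_wpDl// mulr_ge0// sqrtr_ge0. Qed.

Lemma deep_inner_cells T Om (e : R) l : 0 < e -> (0 < T)%N ->
  deep Om deep_width (e * T%:R) l -> inner_cells T Om e l.
Proof.
move=> e0 T0; have h0 : 0 < e * T%:R by rewrite mulr_gt0// ltr0n.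
move=> lOm; rewrite /inner_cells /= eps_cubeE// => x xl; apply: lOm.
apply/ballP => [|m]; first by rewrite mulr_gt0// deep_width_gt0.
rewrite -xl; apply: le_lt_trans (grid_point_cell x m h0) _.
by rewrite ltr_pMl// /deep_width; have := sqrtr_ge0 (d%:R : R); lra.
Qed.

(** The Euclidean norm dominates the sup norm, so a boundary point closer than the radius of the
    ball would lie in Om, which is open and hence disjoint from its boundary. If the boundary is
    empty the distance is +oo. *)
Lemma deep_deep_cells T Om (e : R) l : open Om -> 0 < e -> (0 < T)%N ->
  deep Om deep_width (e * T%:R) l -> deep_cells T Om e l.
Proof.
move=> oOm e0 T0 lOm; have h0 : 0 < e * T%:R by rewrite mulr_gt0// ltr0n.
have kh : 0 < deep_width * (e * T%:R) by rewrite mulr_gt0// deep_width_gt0.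
rewrite /deep_cells /= grid_point_scale; split; first by apply: lOm; exact: ballxx.
apply: (@lt_le_trans _ _ (deep_width * (e * T%:R))%:E).
  rewrite lte_fin (_ : 2 * e * _ * _ = 2 * Num.sqrt d%:R * (e * T%:R)); last ring.
  by rewrite ltr_pM2r// /deep_width ltrDl.
apply: le_ereal_inf_tmp => _ [y [_ yOm] <-]; rewrite lee_fin leNgt; apply/negP => yl.
apply: yOm; apply: oOm; apply: lOm; apply/ballP => // m.
by apply: le_lt_trans yl; have := le_enorm (grid_point (e * T%:R) l - y) m; rewrite !mxE.
Qed.

(** Half of the homogeneity in the weight, checked on finite partial sums; it links the weight 1 of
    [poincare_width] to the weight of the energy bound. *)
Lemma energy_scale X T (A : set 'rV[R]_d) (w : R) v : 0 < w ->
  (energy X T A 1 v <= w^-1%:E * energy X T A w v)%E.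
Proof.
move=> w0; apply: ge_ereal_sup => _ [F [fF FA] <-].
have [s us sE] : exists2 s : seq (site d k * site d k), uniq s & [set` s] = F.
  have /finite_seqP[s ->] := fF; exists (undup s); first exact: undup_uniq.
  by apply/seteqP; split => ij /=; rewrite mem_undup.
rewrite -sE -fsbig_seq//.
apply: (@le_trans _ _ (w^-1%:E * \sum_(ij <- s) (w * `|v ij.1 - v ij.2| ^+ 2)%:E)%E).
  rewrite !sumEFin -EFinM lee_fin mulr_sumr le_eqVlt; apply/orP; left; apply/eqP.
  by apply: eq_bigr => ij _; rewrite mul1r mulrA mulVf ?mul1r// gt_eqF.
rewrite lee_pmul2l ?lte_fin ?invr_gt0//; apply: esum_ge_seq => //.
by rewrite sE.
Qed.

Lemma piecewise_meanE X T Om (e : R) v (x : 'rV[R]_d) : 0 < e -> (0 < T)%N ->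
  inner_cells T Om e (cell_of (e * T%:R) x) ->
  piecewise_mean X T Om e v x = cell_mean (R := R) X T v (cell_of (e * T%:R) x).
Proof.
move=> e0 T0 xin; rewrite /piecewise_mean (@fsbigE _ _ _ _ _ [:: cell_of (e * T%:R) x])//.
- by rewrite big_cons big_nil ifT ?inE//= addr0 eps_cubeE// indicE mem_set ?mulr1.
- by move=> l /=; rewrite inE => /eqP ->.
- move=> l _; rewrite inE => lx; rewrite indicE memNset ?mulr0// eps_cubeE// => xl.
  by move/eqP: lx; apply; rewrite -xl.
Qed.

End reduction.

(** * Discrete bounds for the cell means, and passage to [H1] *)

Section final.
Context {R : realType} {d k : nat}.
Local Notation unit_vec m := (delta_mx ord0 m : 'rV[int]_d).
Local Notation mu := (@lebesgue_rV R d).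

Lemma cell_mean_l2_bound (X : set (site d k)) T (e C : R) (v : site d k -> R) s :
  0 < e -> uniq s ->
  (\esum_(l in [set: 'rV[int]_d]) \esum_(i in sites X T (@cube R d T l))
     (e ^+ d * `|v i| ^+ 2)%:E <= C%:E)%E ->
  (e * T%:R) ^+ d * \sum_(l <- s) cell_mean (R := R) X T v l ^+ 2 <=
  T%:R ^+ d * (T.*2.+1 ^ d * T.*2.+1 ^ k)%:R * C.
Proof.
move=> e0 us vC; set B := (_ * _)%N.
have /choice[r rP] l := @sqr_cell_mean_le R d k X T v l.
have : \sum_(l <- s) \sum_(i <- r l) e ^+ d * `|v i| ^+ 2 <= C.
  rewrite -lee_fin; apply: le_trans vC.
  apply: le_trans (esum_ge_seq _ us (@subsetT _ _)).
  rewrite -sumEFin; apply: lee_sum => l _; rewrite -sumEFin.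
  by have [ur rE _] := rP l; apply: esum_ge_seq; rewrite ?rE.
move=> sC; rewrite exprMn [X in X * _]mulrC -!mulrA ler_wpM2l ?exprn_ge0//.
apply: (@le_trans _ _ (B%:R * (\sum_(l <- s) \sum_(i <- r l) e ^+ d * `|v i| ^+ 2))); last first.
  by rewrite ler_wpM2l.
rewrite !mulr_sumr; apply: ler_sum => l _; have [_ _ h] := rP l.
apply: (@le_trans _ _ (e ^+ d * (B%:R * \sum_(i <- r l) v i ^+ 2))).
  by rewrite ler_wpM2l// exprn_ge0// ltW.
rewrite mulrCA ler_wpM2l// mulr_sumr; apply: ler_sum => i _.
by rewrite real_normK ?num_real.
Qed.

Lemma cell_mean_gradient_bound (X : set (site d k)) T (Om : set 'rV[R]_d)
    (M C' e C : R) (v : site d k -> R) m t :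
  open Om -> 0 < e -> (0 < T)%N -> 0 < C' ->
  (forall v l l', enorm (rvec (l - l') : 'rV[R]_d) = 1 ->
      ((`|cell_mean X T v l - cell_mean X T v l'| ^+ 2)%:E
        <= C'%:E * energy X T (fat_pair T M l l') 1 v)%E) ->
  (\esum_(ll in deep_pairs T Om e)
     energy X T (fat_pair T M ll.1 ll.2) (e ^ (d%:Z - 2)) v <= C%:E)%E ->
  uniq t ->
  {in t, forall p, deep Om (@deep_width R d) (e * T%:R) p /\
     deep Om (@deep_width R d) (e * T%:R) (p + unit_vec m)} ->
  (e * T%:R) ^+ d *
    \sum_(p <- t) (cell_mean (R := R) X T v (p + unit_vec m) - cell_mean X T v p) ^+ 2 <=
  (T%:R ^+ d * C' * C) * (e * T%:R) ^+ 2.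
Proof.
move=> oOm e0 T0 C'0 vP vC ut tP; set w := e ^ (d%:Z - 2) in vC.
have w0 : 0 < w by rewrite exprz_gt0.
(* The exponent d - 2 may be negative, hence an integer power. The two missing powers of e are the
   factor that makes the unit differences of order h. *)
have ew : e ^+ d = w * e ^+ 2.
  by rewrite -[e ^+ d]/(e ^ d%:Z) -[e ^+ 2]/(e ^ 2%:Z) -expfzDr ?gt_eqF// subrK.
pose f p := (p + unit_vec m, p).
have uf : uniq (map f t) by rewrite map_inj_uniq// => p q [].
have fdeep : [set` map f t] `<=` deep_pairs T Om e.
  move=> _ /mapP[p /tP[dp dpe] ->]; split => /=; [exact: deep_deep_cells..|].
  by rewrite addrAC subrr add0r enorm_delta.
have energyC : (\sum_(p <- t) energy X T (fat_pair T M (p + unit_vec m) p) w v <= C%:E)%E.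
  apply: le_trans vC; apply: le_trans (esum_ge_seq _ uf fdeep).
  by rewrite big_map.
have C0 : 0 <= C.
  rewrite -lee_fin; apply: le_trans energyC; apply: sume_ge0 => p _.
  by apply: esum_ge0 => ij _; rewrite lee_fin mulr_ge0 ?sqr_ge0// ltW.
have sumC : \sum_(p <- t)
    w * (cell_mean (R := R) X T v (p + unit_vec m) - cell_mean X T v p) ^+ 2 <= C' * C.
  rewrite -lee_fin -sumEFin EFinM.
  apply: le_trans (_ : (C'%:E * \sum_(p <- t)
      energy X T (fat_pair T M (p + unit_vec m) p) w v <= _)%E); last first.
    by rewrite lee_pmul2l// ?lte_fin.
  rewrite ge0_sume_distrr; last first.
    by move=> p _; apply: esum_ge0 => ij _; rewrite lee_fin mulr_ge0 ?sqr_ge0// ltW.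
  apply: lee_sum => p _.
  have := vP v (p + unit_vec m) p; rewrite addrAC subrr add0r => /(_ (enorm_delta m)).
  rewrite real_normK ?num_real// => h.
  rewrite EFinM; apply: (@le_trans _ _
    (w%:E * (C'%:E * (w^-1%:E * energy X T (fat_pair T M (p + unit_vec m) p) w v)))%E).
    rewrite lee_pmul2l ?lte_fin//; apply: le_trans h _.
    by rewrite lee_pmul2l ?lte_fin//; exact: energy_scale.
  by rewrite muleCA [(w%:E * _)%E]muleA -EFinM mulfV ?gt_eqF// mul1e.
rewrite exprMn ew -mulrA mulrCA; set S := \sum_(_ <- _) _.
have {}sumC : w * S <= C' * C by rewrite mulr_sumr.
have T1 : 1 <= T%:R :> R by rewrite ler1n.
have e2 : 0 <= e ^+ 2 by exact: sqr_ge0.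
apply: (@le_trans _ _ (T%:R ^+ d * e ^+ 2 * (C' * C))).
  rewrite [leLHS](_ : _ = T%:R ^+ d * e ^+ 2 * (w * S)); last by ring.
  by rewrite ler_wpM2l// mulr_ge0// exprn_ge0.
(* T >= 1 is spent here to enlarge e^2 into h^2. *)
rewrite [leRHS](_ : _ = T%:R ^+ d * e ^+ 2 * (C' * C) * T%:R ^+ 2); last by ring.
rewrite ler_peMr ?exprn_ege1//; apply: mulr_ge0; last by rewrite mulr_ge0// ltW.
by rewrite mulr_ge0// exprn_ge0.
Qed.

Lemma Lnorm2_le (f : 'rV[R]_d -> R) (c : R) : 0 <= c ->
  (sqint mu setT f <= (c ^+ 2)%:E)%E -> ('N[mu]_2%:E [EFin \o f] <= c%:E)%E.
Proof.
move=> c0 fc; rewrite unlock /=.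
have -> : (\int[mu]_x (`|(EFin \o f) x| `^ 2))%E = sqint mu setT f.
  by apply: eq_integral => x _; rewrite /= powR_mulrn// -normrX ger0_norm// sqr_ge0.
apply: (@le_trans _ _ ((c ^+ 2)%:E `^ 2^-1)%E).
  by apply: gt0_ler_poweR; rewrite // in_itv /= leey ?sqint_ge0// lee_fin sqr_ge0.
by rewrite poweR_EFin powR12_sqrt ?sqr_ge0// sqrtr_sqr ger0_norm.
Qed.

(** Integrals over Om become inner products over the whole space, because the truncated u and the
    test function vanish off Om. *)
Lemma H1_limit (Om : set 'rV[R]_d) (u : 'rV[R]_d -> R) : open Om ->
  sqintegrable mu (u \_ Om) ->
  (forall m : 'I_d, exists2 w, sqintegrable mu w &
    forall phi, test_function Om phi ->
      ip mu (u \_ Om) (partial m phi) = - ip mu w phi) ->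
  H1 Om (u \_ Om).
Proof.
move=> oOm su uw; have mOm := measurable_open oOm.
have outside (f : 'rV[R]_d -> R) x : ~ Om x -> (f \_ Om) x = 0.
  by move=> xO; rewrite patchE memNset.
split.
  apply: L2E; rewrite (_ : (u \_ Om) \_ Om = u \_ Om)//; apply/funext => x.
  by have [Ox|Ox] := pselect (Om x); [rewrite patchE mem_set|rewrite !outside].
move=> m; have [w sw wP] := uw m; exists w.
  apply: L2E; have [mw lw] := sw; apply: sqintegrable_restrict => //.
  exact: (le_lt_trans (sub_sqint mu mOm measurableT mw (@subsetT _ Om)) lw).
move=> phi tphi; have [S [_ SOm phiS dphiS]] := test_function_support m tphi.
have integralT (f g : 'rV[R]_d -> R) : (forall x, ~ Om x -> f x * g x = 0) ->
    (\int[mu]_(x in Om) (f x * g x)%:E = \int[mu]_x (f x * g x)%:E)%E.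
  move=> fg0; rewrite integral_mkcond; apply: eq_integral => x _; rewrite patchE.
  by case: ifPn => // /negP xO; rewrite fg0// => Ox; apply: xO; rewrite inE.
rewrite !integralT; last 2 first.
- move=> x xO; have [->|/phiS/SOm//] := eqVneq (phi x) 0; exact: mulr0.
- by move=> x xO; rewrite outside ?mul0r.
have [s_phi s_dphi] := test_function_sqintegrable m tphi.
by rewrite !integral_ip// wP.
Qed.

End final.

Theorem proposition4p1 (R : realType) (d k T : nat)
  (hd : (1 <= d)%N) (hk : (1 <= k)%N) (hT : (1 <= T)%N)
  (X : set (site d k)) (E : set (site d k * site d k))
  (X_nonempty : X !=set0)
  (X_layer : forall i, X i -> forall m, 0 <= i.2 ord0 m < T%:Z)
  (E_sub : E `<=` X `*` X)
  (X_periodic : forall m : 'I_d, [set site_shift T m i | i in X] = X)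
  (E_periodic : forall m : 'I_d,
     [set (site_shift T m ij.1, site_shift T m ij.2) | ij in E] = E)
  (E_connected : forall i j, X i -> X j ->
     exists2 s : seq (site d k), path (fun a b => (a, b) \in E) i s
                               & last i s = j)
  (r : R) (r_gt0 : 0 < r) (r_leT : r <= T%:R)
  (E_range : forall i j, E (i, j) -> site_norm (i - j) <= r)
  (M : R) (M_gt0 : 0 < M) (M_poincare : poincare_width X T M)
  (Om : set 'rV[R]_d) (Om_open : open Om) (Om_lip : lipschitz_boundary Om)
  (u : R -> 'rV[R]_d * 'rV[R]_k -> R) (C : R)
  (bound_L2 : forall e : R, 0 < e ->
     (\esum_(l in [set: 'rV[int]_d])
        \esum_(i in sites X T (@cube R d T l))
          (e ^+ d * `|sample T Om u e i| ^+ 2)%:E <= C%:E)%E)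
  (bound_energy : forall e : R, 0 < e ->
     (\esum_(ll in deep_pairs T Om e)
        energy X T (fat_pair T M ll.1 ll.2) (e ^ (d%:Z - 2))
          (sample T Om u e) <= C%:E)%E)
  (eps : nat -> R) (eps_gt0 : forall n, 0 < eps n)
  (eps_cvg0 : eps n @[n --> \oo] --> (0 : R)) :
  exists phi : nat -> nat,
    {homo phi : m n / (m < n)%N} /\
    exists2 u0 : 'rV[R]_d -> R, H1 Om u0 &
      cvg_L2loc Om
        (fun n => piecewise_mean X T Om (eps (phi n))
                    (sample T Om u (eps (phi n)))) u0.
Proof.
have [C' C'0 C'P] := M_poincare.
pose h n : R := eps n * T%:R.
pose v n := cell_mean (R := R) X T (sample T Om u (eps n)).
have h0 n : 0 < h n by rewrite mulr_gt0// ltr0n.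
have hcvg : h n @[n --> \oo] --> 0.
  by rewrite -[0](mul0r T%:R); apply: cvgM => //; exact: cvg_cst.
have k0 := @deep_width_gt0 R d.
have k2 : 0 < @deep_width R d + 2 by exact: addr_gt0.
have vC1 n s : uniq s -> h n ^+ d * \sum_(l <- s) v n l ^+ 2 <=
    T%:R ^+ d * (T.*2.+1 ^ d * T.*2.+1 ^ k)%:R * C.
  by move=> us; apply: cell_mean_l2_bound us _ => //; exact: bound_L2.
have vC2 n := fun m t => @cell_mean_gradient_bound R d k X T Om M C' (eps n) C
  (sample T Om u (eps n)) m t Om_open (eps_gt0 n) hT C'0 C'P (bound_energy _ (eps_gt0 n)).
have [phi [phi_homo [w mw [C3 wC3]]]] := strong_compactness h0 hcvg k0 vC1 vC2.
have phi_ge n : (n <= phi n)%N.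
  elim: n => // n IHn; exact: leq_ltn_trans IHn (phi_homo _ _ (ltnSn n)).
have phi_oo : phi n @[n --> \oo] --> \oo.
  move=> A [N _ NA]; exists N => // n /= Nn; apply: NA.
  exact: leq_trans Nn (phi_ge n).
exists phi; split => //.
pose h' n := h (phi n); pose v' n := v (phi n).
have h'0 n : 0 < h' n by exact: h0.
have h'cvg : h' n @[n --> \oo] --> 0 by exact: (cvg_comp _ _ phi_oo hcvg).
have v'C1 n := vC1 (phi n).
have v'C2 n := vC2 (phi n).
have wC i n : (i <= n)%N -> (sqint (@lebesgue_rV R d) (inner_set Om i)
    (fun x => v' n (cell_of (h' n) x) - w x)%R <= (C3 / 4 ^+ n)%:E)%E.
  move=> ni; apply: le_trans (wC3 n); apply: sub_sqint.
  - exact: measurable_inner_set.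
  - exact: measurable_inner_set.
  - apply: measurable_funB => //.
    by apply: measurable_fun_countable => l; exact: measurable_grid_cell.
  - exact: inner_set_mono.
exists (w \_ Om).
  apply: H1_limit => //; first exact: (limit_sqintegrable Om_open h'0 v'C1 mw wC).
  move=> m; exact: (limit_weak_partial Om_open h'0 h'cvg k0 v'C1 v'C2 mw wC m).
move=> K cK KOm; have [i Ki] := compact_sub_inner_set Om_open cK KOm.
have mK : measurable K by apply: measurable_closed; exact: compact_closed cK.
have C30 : 0 <= C3.
  have := le_trans (sqint_ge0 _ _ _) (wC 0%N 0%N (leqnn _)).
  by rewrite lee_fin expr0 divr1.
(* The upper function is the square root of the bound C3/4^n on the squared norm over K. *)
apply: (@squeeze_cvge _ _ _ _ (cst 0%E) _ (fun n => (Num.sqrt C3 * 2^-1 ^+ n)%:E)).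
- have small : \forall n \near \oo, h' n <= i.+1%:R^-1 / (@deep_width R d + 2).
    by apply: (cvgr_le _ h'cvg); rewrite divr_gt0 ?invr_gt0.
  apply: filterS2 small (nbhs_infty_ge i) => n small ni; rewrite Lnorm_ge0/=.
  have kn : 0 <= Num.sqrt C3 * 2^-1 ^+ n by rewrite mulr_ge0// ?sqrtr_ge0// exprn_ge0.
  apply: Lnorm2_le => //.
  have -> : (Num.sqrt C3 * 2^-1 ^+ n) ^+ 2 = C3 / 4 ^+ n.
    rewrite exprMn sqr_sqrtr// -exprM mulnC exprM -exprVn; congr (_ * _ ^+ _).
    by rewrite expr2 -invfM -natrM.
  rewrite -sqint_restrict; apply: le_trans (wC i n ni).
  rewrite (@eq_sqint _ _ _ _ _ _ (fun x => v' n (cell_of (h' n) x) - w x)%R).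
    apply: sub_sqint => //; first exact: measurable_inner_set.
    apply: measurable_funB => //.
    by apply: measurable_fun_countable => l; exact: measurable_grid_cell.
  (* A point of K has room 1/(i+1) >= (2 + [deep_width]) h inside Om, so its cell is deep, hence
     inner, and the piecewise mean at x is the mean of that cell. *)
  move=> x Kx /=; rewrite patchE mem_set; last exact: KOm.
  congr (_ - _); apply: piecewise_meanE => //; apply: deep_inner_cells => //.
  have [_ xOm] := Ki _ Kx; apply: subset_trans xOm => y.
  rewrite -/(h (phi n)) -/(h' n) => xy.
  have wh : (@deep_width R d + 2) * h' n <= i.+1%:R^-1.
    by move: small; rewrite ler_pdivlMr// mulrC.
  apply: (@le_ball _ _ _ (2 * h' n + @deep_width R d * h' n)).
    by apply: le_trans wh; rewrite -mulrDl addrC.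
  apply: ball_triangle xy; apply/ballP => [|m]; first by rewrite mulr_gt0.
  rewrite distrC; apply: le_lt_trans (grid_point_cell x m (h'0 n)) _.
  by rewrite ltr_pMl// ltr1n.
- exact: cvg_cst.
- apply: cvg_EFin; first exact: nearW.
  rewrite -[0](mulr0 (Num.sqrt C3)); apply: cvgM; first exact: cvg_cst.
  by apply: cvg_expr; rewrite ger0_norm ?invf_lt1 ?ltr1n.
Qed.
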